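(* Let $K$ be a field, $S=K[x_1,\ldots,x_n]$ a standard graded polynomial ring, and let $e,d$ be integers with $2\leq e\leq d$. Let $I\subseteq S$ be a monomial ideal all of whose minimal monomial generators have degree between $e$ and $d$ (inclusive). Put $R=S/I$, $p=\operatorname{pd}_S R$ and $t_i=t_i(R)$ for $0\le i\le p$. If $p\geq 2$ and $t_2<2e$, then $$t_i\leq\left\lceil\frac{(2d-1)i}{2}\right\rceil-2(d-e)\qquad\text{for all integers } i \text{ with } 2\leq i\leq p.$$
   Context: For a graded quotient $R=S/I$, let $\beta^S_{i,j}(R)=\dim_K \operatorname{Tor}^S_i(R,K)_j$ be its graded Betti numbers and $\operatorname{pd}_S R$ its projective dimension over $S$. For $0\leq i\leq \operatorname{pd}_S R$, the $i$-th maximal shift is $t_i(R)=\max\{j:\beta^S_{i,j}(R)\neq 0\}$ (with $t_0(R)=0$). *)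

(* Defs.v *)
From HB Require Import structures.
From mathcomp Require Import all_boot all_order all_algebra.
From mathcomp Require Export mpoly.

Set Implicit Arguments.
Unset Strict Implicit.
Unset Printing Implicit Defensive.

Import Order.TTheory GRing.Theory Num.Theory.
Local Open Scope ring_scope.

Definition monomial_ideal (n : nat) (K : fieldType)
    (I : {mpoly K[n]} -> Prop) : Prop :=
  exists G : 'X_{1..n} -> Prop, forall f,
    I f <-> exists s : seq ({mpoly K[n]} * 'X_{1..n}),
      (forall x, x \in s -> G x.2) /\ f = \sum_(x <- s) x.1 * 'X_[x.2].

(* [(m' <= m)%MM] is divisibility of monomials. *)
Definition minimal_generator (n : nat) (K : fieldType)
    (I : {mpoly K[n]} -> Prop) (m : 'X_{1..n}) : Prop :=
  I 'X_[m] /\ forall m' : 'X_{1..n}, I 'X_[m'] -> (m' <= m)%MM -> m' = m.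

(* [pi] exhibits [R] as the quotient of [A] by [I]. *)
Definition quotient_map (A : nzRingType) (I : A -> Prop) (R : lmodType A)
    (pi : {linear A^o -> R}) : Prop :=
  (forall y : R, exists f : A, pi f = y) /\ (forall f : A, pi f = 0 <-> I f).

Definition projective (A : nzRingType) (P : lmodType A) : Prop :=
  forall (M N : lmodType A) (g : {linear M -> N}) (f : {linear P -> N}),
    (forall y, exists x, g x = y) ->
    exists h : {linear P -> M}, forall x, g (h x) = f x.

(* 0 -> P_p -> ... -> P_1 -> P_0 -> R -> 0, with P_i = 0 for i > p *)
Definition has_projective_resolution (A : nzRingType) (R : lmodType A)
    (p : nat) : Prop :=
  exists (P : nat -> lmodType A) (d : forall i, {linear P i.+1 -> P i})
         (eps : {linear P 0 -> R}),
    [/\ forall i, projective (P i),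
        forall i, (p < i)%N -> forall x : P i, x = 0,
        forall y, exists x, eps x = y,
        forall x, eps x = 0 <-> exists y, x = d 0 y
      & forall i x, d i x = 0 <-> exists y, x = d i.+1 y].

Definition projective_dimension (A : nzRingType) (R : lmodType A) (p : nat)
    : Prop :=
  has_projective_resolution R p /\
  forall q, has_projective_resolution R q -> (p <= q)%N.

(* A graded resolution of the quotient R of S = K[x_1,...,x_n] by free modules
   F_i = \bigoplus_c S(- gr_deg i c), the sum being over the gr_rank i elements
   of the standard basis.  Elements of F_i are row vectors and the differential
   F_{i+1} -> F_i is u |-> u *m gr_diff i.  The two homogeneity conditions say
   that the differentials and the augmentation F_0 -> R have degree 0, where R
   carries the grading R_j = pi (S_j). *)
Record graded_free_resolution (n : nat) (K : fieldType)
    (R : lmodType {mpoly K[n]}) (pi : {linear {mpoly K[n]}^o -> R}) :=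
  GradedFreeResolution {
    gr_rank : nat -> nat;
    gr_deg : forall i, 'I_(gr_rank i) -> nat;
    gr_diff : forall i, 'M[{mpoly K[n]}]_(gr_rank i.+1, gr_rank i);
    gr_aug : {linear 'rV[{mpoly K[n]}]_(gr_rank 0) -> R};
    gr_diff_homog : forall i r c m, m \in msupp (gr_diff i r c) ->
      (mdeg m + gr_deg c)%N = gr_deg r;
    gr_aug_homog : forall c, exists f : {mpoly K[n]},
      f \is (gr_deg c).-homog /\ gr_aug (delta_mx 0 c) = pi f;
    gr_aug_surj : forall y, exists u, gr_aug u = y;
    gr_aug_exact : forall u, gr_aug u = 0 <-> exists v, u = v *m gr_diff 0;
    gr_diff_exact : forall i (u : 'rV_(gr_rank i.+1)),
      u *m gr_diff i = 0 <-> exists v, u = v *m gr_diff i.+1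
  }.

(* F_i \otimes_S K has a basis indexed by that of F_i; since K = S/(x_1,...,x_n),
   its differentials are the constant terms of those of F. *)
Definition tensor_diff (n : nat) (K : fieldType) (R : lmodType {mpoly K[n]})
    (pi : {linear {mpoly K[n]}^o -> R}) (F : graded_free_resolution pi)
    (i : nat) : 'M[K]_(gr_rank F i.+1, gr_rank F i) :=
  map_mx (mcoeff 0%MM) (gr_diff F i).

(* Below, subspaces are row spaces: this one is (F_i \otimes_S K)_j. *)
Definition tensor_degree (n : nat) (K : fieldType) (R : lmodType {mpoly K[n]})
    (pi : {linear {mpoly K[n]}^o -> R}) (F : graded_free_resolution pi)
    (i j : nat) : 'M[K]_(gr_rank F i) :=
  diag_mx (\row_c (gr_deg c == j)%:R).

Definition tensor_cycles (n : nat) (K : fieldType) (R : lmodType {mpoly K[n]})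
    (pi : {linear {mpoly K[n]}^o -> R}) (F : graded_free_resolution pi)
    (i j : nat) : 'M[K]_(gr_rank F i) :=
  match i return 'M[K]_(gr_rank F i) with
  | 0 => tensor_degree F 0 j
  | i'.+1 => (tensor_degree F i'.+1 j :&: kermx (tensor_diff F i'))%MS
  end.

Definition tensor_boundaries (n : nat) (K : fieldType)
    (R : lmodType {mpoly K[n]}) (pi : {linear {mpoly K[n]}^o -> R})
    (F : graded_free_resolution pi) (i j : nat)
    : 'M[K]_(gr_rank F i.+1, gr_rank F i) :=
  tensor_degree F i.+1 j *m tensor_diff F i.

(* \dim_K Tor^S_i(R, K)_j = \dim_K H_i(F \otimes_S K)_j; the boundaries are
   contained in the cycles, so the subtraction is not truncated. *)
Definition betti (n : nat) (K : fieldType) (R : lmodType {mpoly K[n]})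
    (pi : {linear {mpoly K[n]}^o -> R}) (F : graded_free_resolution pi)
    (i j : nat) : nat :=
  (\rank (tensor_cycles F i j) - \rank (tensor_boundaries F i j))%N.

Definition maximal_shift (n : nat) (K : fieldType) (R : lmodType {mpoly K[n]})
    (pi : {linear {mpoly K[n]}^o -> R}) (F : graded_free_resolution pi)
    (i t : nat) : Prop :=
  betti F i t <> 0%N /\ forall j, betti F i j <> 0%N -> (j <= t)%N.

(* Main.v *)
From HB Require Import structures.
Require Import Defs.
From mathcomp Require Import all_boot all_order all_algebra zify lra.
From Stdlib Require Import Classical ClassicalEpsilon.

(* Tor(S/I, K) is computed by the Taylor complex on words (rather than subsets)
   of minimal generators: its part of multidegree m is spanned by the words of
   lcm m.  On words the cochain differential has the recursive form
   (df)(a s) = f(s) - (d(f(a _)))(s), so contraction with a generator u dividing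
   m is a null-homotopy, and a cocycle f of multidegree m is the coboundary of
   h_u = f(u _), which lives on multidegrees m' with lcm(u, m') = m.
   Clearing the multidegrees with vanishing cohomology from h_u yields
   t_{i+1} <= t_i + d.

   If deg m >= t_i + 2d and f has degree i+2, take two distinct generators u, v
   dividing m.  Then h_u - h_v is the coboundary of the contraction of f with
   the word uv.  Since t_2 < 2e <= 2d, the Koszul cycle uv is a boundary up to
   words whose lcm has degree < 2d, so this contraction may be replaced by a
   cochain in multidegrees > t_i, where the cohomology of degree i vanishes.
   Hence it can be pushed into the multidegrees where h_u or h_v lives, and h_u
   can be corrected to a cochain on the m' with lcm(u, m') = m = lcm(v, m').
   For m' <> m the cohomology of degree i+1 could only be nonzero there if
   m = u m' = v m', which is absurd, so f is a coboundary.  Thus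
   t_{i+2} <= t_i + 2d - 1, and induction from t_2 <= 2e - 1 and t_3 <= t_2 + d
   gives the bound. *)

Set Implicit Arguments.
Unset Strict Implicit.
Unset Printing Implicit Defensive.

Import Order.TTheory GRing.Theory Num.Theory.
Local Open Scope ring_scope.

(** * Cochains on words of generators *)

(** Unfolded, this is the alternating sum of [f] over the words obtained from [s] by deleting one
    letter, with sign +1 for the first letter. The recursion keeps positions and signs out of the
    proofs. *)
Fixpoint coboundary (T : Type) (V : zmodType) (f : seq T -> V) (s : seq T) : V :=
  if s is a :: s' then f s' - coboundary (fun t => f (a :: t)) s' else 0.

Section Coboundary.
Variables (T : eqType) (V : zmodType).
Implicit Types (f : seq T -> V) (s t w : seq T).

Lemma eq_coboundary f1 f2 s :
    (forall t, subseq t s -> size s = (size t).+1 -> f1 t = f2 t) ->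
  coboundary f1 s = coboundary f2 s.
Proof.
elim: s f1 f2 => [//|a s IHs] f1 f2 eqf /=.
rewrite eqf ?subseq_cons //; congr (_ - _).
by apply: IHs => t sub_ts sz; apply: eqf => /=; rewrite ?eqxx ?sz.
Qed.

Lemma coboundary0 s : coboundary (fun=> 0 : V) s = 0.
Proof. by elim: s => [//|a s IHs] /=; rewrite IHs subr0. Qed.

Lemma coboundaryB f1 f2 s :
  coboundary (fun t => f1 t - f2 t) s = coboundary f1 s - coboundary f2 s.
Proof.
elim: s f1 f2 => [|a s IHs] f1 f2 /=; first by rewrite subr0.
by rewrite IHs [in LHS]opprD addrACA -opprD.
Qed.

Lemma coboundaryN f s : coboundary (fun t => - f t) s = - coboundary f s.
Proof.
rewrite -[RHS]add0r -(coboundary0 s) -coboundaryB.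
by apply: eq_coboundary => t _ _; rewrite add0r.
Qed.

Lemma coboundaryD f1 f2 s :
  coboundary (fun t => f1 t + f2 t) s = coboundary f1 s + coboundary f2 s.
Proof.
rewrite -[X in _ + X]opprK -coboundaryN -coboundaryB.
by apply: eq_coboundary => t _ _; rewrite opprK.
Qed.

Lemma coboundary_sum (J : Type) (r : seq J) (P : pred J) (F : J -> seq T -> V) s :
  coboundary (fun t => \sum_(j <- r | P j) F j t) s =
  \sum_(j <- r | P j) coboundary (F j) s.
Proof.
elim: r => [|j r IHr].
  rewrite big_nil -[RHS](coboundary0 s).
  by apply: eq_coboundary => t _ _; rewrite big_nil.
rewrite big_cons -IHr; case: ifP => Pj; last first.
  by apply: eq_coboundary => t _ _; rewrite big_cons Pj.
by rewrite -coboundaryD; apply: eq_coboundary => t _ _; rewrite big_cons Pj.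
Qed.

Lemma coboundaryK f s : coboundary (coboundary f) s = 0.
Proof.
elim: s f => [//|a s IHs] f /=.
by rewrite coboundaryB IHs subr0 subrr.
Qed.

Lemma coboundary_support f s :
    coboundary f s != 0 ->
  exists t, [/\ subseq t s, size s = (size t).+1 & f t != 0].
Proof.
move=> nz; apply: NNPP => none; case/eqP: nz.
rewrite -(coboundary0 s); apply: eq_coboundary => t sub_ts sz.
by apply/eqP; apply: contraT => ft; case: none; exists t.
Qed.

(* The Leibniz rule for the contraction of a cochain with the word [w]. *)
Lemma coboundary_cat f w s :
  coboundary f (w ++ s) =
    coboundary (fun w' => f (w' ++ s)) w
    + coboundary (fun t => f (w ++ t)) s *~ (-1) ^+ size w.
Proof.
elim: w f => [|a w IHw] f /=; first by rewrite add0r.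
by rewrite IHw exprS mulN1r mulrNz opprD addrA.
Qed.

End Coboundary.

Lemma coboundaryZ (T : eqType) (R : pzRingType) (V : lmodType R) (a : R)
    (f : seq T -> V) s :
  coboundary (fun t => a *: f t) s = a *: coboundary f s.
Proof. by elim: s f => [|b s IHs] f /=; rewrite ?scaler0 // IHs scalerBr. Qed.

(** * Cochains supported on sets of multidegrees *)

Section LcmCochains.
Variables (n : nat) (T : eqType) (g : T -> 'X_{1..n}) (K : zmodType).
Implicit Types (f h : seq T -> K) (s t : seq T) (m : 'X_{1..n}).
Implicit Types (U V : pred 'X_{1..n}).

Definition lcm_word s : 'X_{1..n} := foldr (fun a => mlcm (g a)) 0%MM s.

Local Notation L := lcm_word.

Lemma lem_lcm_word m s : (L s <= m)%MM = all (fun a => (g a <= m)%MM) s.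
Proof.
elim: s => [|a s IHs] /=; last by rewrite lem_mlcm IHs.
by apply/mnm_lepP => i; rewrite mnm0E.
Qed.

Lemma lcm_word_subseq t s : subseq t s -> (L t <= L s)%MM.
Proof.
have := lepm_refl (L s); rewrite {1}lem_lcm_word => /allP le_s /mem_subseq sub.
by rewrite lem_lcm_word; apply/allP => a /sub /le_s.
Qed.

Lemma lem_mdeg m1 m2 : (m1 <= m2)%MM -> (mdeg m1 <= mdeg m2)%N.
Proof. by move/submK <-; rewrite mdegD leq_addl. Qed.

Lemma lem_mdeg_eq m1 m2 : (m1 <= m2)%MM -> (mdeg m2 <= mdeg m1)%N -> m1 = m2.
Proof.
move=> le12; rewrite -{1}(submK le12) mdegD => le21.
have : mdeg (m2 - m1)%MM == 0%N by move: le21; lia.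
by rewrite mdeg_eq0 => /eqP e; rewrite -(submK le12) e add0m.
Qed.

Lemma lem_anti m1 m2 : (m1 <= m2)%MM -> (m2 <= m1)%MM -> m1 = m2.
Proof. by move=> le12 /lem_mdeg; apply: lem_mdeg_eq. Qed.

Lemma mdeg_mlcm m1 m2 : (mdeg (mlcm m1 m2) <= mdeg m1 + mdeg m2)%N.
Proof. by rewrite mlcmE mdegD leq_add2l lem_mdeg // lem_subr. Qed.

(* [acyclic k m] says that H^k vanishes for the cochains of words of lcm exactly
   [m]; these compute Tor_k(S/I, K)_m. *)
Definition acyclic k m : Prop := forall f,
  (forall s, f s != 0 -> L s = m) ->
  (forall s, size s = k.+1 -> L s = m -> coboundary f s = 0) ->
  exists h, (forall s, h s != 0 -> L s = m) /\
    (forall s, size s = k -> L s = m -> f s = coboundary h s).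

(** Deleting letters can only shrink the lcm, so among the words of lcm dividing [m] the cochains
    supported on such a [U] form a subcomplex. *)
Definition upset m U := forall m1 m2,
  U m1 -> (m1 <= m2)%MM -> (m2 <= m)%MM -> U m2.

Lemma coboundary_upset m U f s : upset m U ->
    (forall t, size s = (size t).+1 -> (L t <= m)%MM -> f t != 0 -> U (L t)) ->
    (L s <= m)%MM -> coboundary f s != 0 -> U (L s).
Proof.
move=> upU supp le_sm /coboundary_support[t [sub_ts sz ft]].
have le_ts := lcm_word_subseq sub_ts.
by apply: (upU _ _ _ le_ts le_sm); apply: supp; rewrite // (lepm_trans le_ts).
Qed.

(** The multidegrees of [U] outside [V] are cleared one total degree at a time, from below: once the
    smaller ones are clear, the part of the cochain on words of lcm exactly [m'] is a cocycle, which
    [acyclic] removes. *)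
Lemma retract_cochain k m U V f : upset m U -> upset m V ->
    (forall s, size s = k -> (L s <= m)%MM -> f s != 0 -> U (L s)) ->
    (forall s, size s = k.+1 -> (L s <= m)%MM -> coboundary f s != 0 ->
       V (L s)) ->
    (forall m', (m' <= m)%MM -> U m' -> ~~ V m' -> acyclic k m') ->
  exists h, (forall s, (L s <= m)%MM -> h s != 0 -> U (L s)) /\
    (forall s, size s = k -> (L s <= m)%MM -> f s != coboundary h s ->
       V (L s)).
Proof.
move=> upU upV suppf suppdf acyc.
(* Invariant: in degrees below [N], [f] minus the coboundary of [h] lives on [V]. *)
suff main N : exists h, (forall s, (L s <= m)%MM -> h s != 0 -> U (L s)) /\
    (forall s, size s = k -> (L s <= m)%MM -> (mdeg (L s) < N)%N ->
       f s != coboundary h s -> V (L s)).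
  have [h [supph eqh]] := main (mdeg m).+1; exists h; split=> // s sz le_sm.
  by apply: eqh; rewrite ?ltnS ?lem_mdeg.
elim: N => [|N [h [supph eqh]]].
  by exists (fun=> 0); split=> [s _|//]; rewrite eqxx.
pose f' s := f s - coboundary h s.
have suppf' s : size s = k -> (L s <= m)%MM -> f' s != 0 -> U (L s).
  move=> sz le_sm; apply: contra_neqT => notU; rewrite /f'.
  have -> : f s = 0 by apply: contraNeq notU; apply: suppf.
  suff -> : coboundary h s = 0 by rewrite subr0.
  by apply: contraNeq notU; apply: (coboundary_upset upU) => // t _; apply: supph.
have df' s : coboundary f' s = coboundary f s.
  by rewrite coboundaryB coboundaryK subr0.
pose good m' h' := (forall s, h' s != 0 -> L s = m') /\
  (forall s, size s = k -> L s = m' -> f' s = coboundary h' s).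
have exh m' : exists h', [&& (m' <= m)%MM, U m', ~~ V m' & mdeg m' == N] ->
    good m' h'.
  case: (boolP [&& _, _, _ & _]) => [/and4P[le_m'm Um' nVm' /eqP dm']|_]; last first.
    by exists (fun=> 0).
  pose fm s := if L s == m' then f' s else 0.
  have [||h' [supph' eqh']] := acyc m' le_m'm Um' nVm' fm.
  - by move=> s; rewrite /fm; case: (L s =P m') => // _; rewrite eqxx.
  (* Cutting [f'] down to [fm] does not change the coboundary at [s]: if [f'] were nonzero on a
     deletion [t] of smaller lcm, the invariant would put that lcm, and hence [m'], in [V]. *)
  - move=> s sz Ls; transitivity (coboundary f' s); last first.
      rewrite df'; apply: contraNeq nVm'; rewrite -Ls.
      by apply: suppdf; rewrite ?Ls.
    apply: eq_coboundary => t sub_ts sz'; rewrite /fm; case: eqP => // neq.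
    have le_ts := lcm_word_subseq sub_ts; rewrite Ls in le_ts.
    have lt_ts : (mdeg (L t) < N)%N.
      by rewrite ltnNge -dm'; apply/negP => /(lem_mdeg_eq le_ts).
    apply/esym; apply: contraNeq nVm'; rewrite subr_eq0 => neq0.
    have le_tm := lepm_trans le_ts le_m'm.
    apply: (upV _ _ _ le_ts le_m'm); apply: eqh => //.
    by apply/eqP; rewrite -eqSS -sz' sz.
  exists h' => _; split=> // s sz Ls.
  by rewrite -eqh' // /fm Ls eqxx.
pose H m' := epsilon (inhabits (fun=> 0)) (fun h' =>
  [&& (m' <= m)%MM, U m', ~~ V m' & mdeg m' == N] -> good m' h').
have HP m' : (m' <= m)%MM -> U m' -> ~~ V m' -> mdeg m' == N -> good m' (H m').
  move=> le_m'm Um' nVm' dm'; apply: (epsilon_spec _ _ (exh m')).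
  by rewrite le_m'm Um' nVm'.
(* All multidegrees of degree [N] are corrected at once; distinct ones do not divide each other, so
   the corrections do not interfere. *)
pose h1 s := if [&& (L s <= m)%MM, U (L s), ~~ V (L s) & mdeg (L s) == N]
  then H (L s) s else 0.
exists (fun s => h s + h1 s); split=> [s le_sm|s sz le_sm ltN].
  have [Us|nUs] := boolP (U (L s)) => //.
  by rewrite /h1 (negPf nUs) andbF addr0 => /(supph _ le_sm); rewrite (negPf nUs).
rewrite coboundaryD; apply: contraNT => nVs.
have suppdh1 t : (mdeg (L t) < N)%N -> h1 t = 0.
  by move=> lt; rewrite /h1 (ltn_eqF lt) !andbF.
move: ltN; rewrite ltnS leq_eqVlt => /orP[/eqP eN|ltN]; last first.
  have -> : coboundary h1 s = 0.
    rewrite -(coboundary0 K s); apply: eq_coboundary => t sub_ts _.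
    by apply: suppdh1; apply: leq_ltn_trans ltN; rewrite lem_mdeg ?lcm_word_subseq.
  by rewrite addr0; apply: contraNT nVs; apply: eqh.
rewrite -subr_eq0 opprD addrA subr_eq0 -/(f' s); apply/eqP.
have [Us|nUs] := boolP (U (L s)); last first.
  transitivity (0 : K); first by apply: contraNeq nUs; apply: suppf'.
  apply/esym; apply: contraNeq nUs; apply: (coboundary_upset upU) => // t _ le_tm.
  by rewrite /h1 le_tm /=; case: (U (L t)); rewrite //= eqxx.
have [suppH eqH] := HP _ le_sm Us nVs (introT eqP eN).
rewrite eqH //; apply: eq_coboundary => t sub_ts sz'.
have le_ts := lcm_word_subseq sub_ts.
have [eLt|neLt] := L t =P L s.
  by rewrite /h1 eLt le_sm Us nVs eN eqxx.
have ltN : (mdeg (L t) < N)%N.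
  by rewrite ltnNge -eN; apply/negP => /(lem_mdeg_eq le_ts).
rewrite suppdh1 //; apply/eqP; apply: contraT => /suppH //.
Qed.

(** Apply [retract_cochain] with [V] reduced to the top multidegree [m]: a coboundary can be
    subtracted from [h] to leave a cochain on [m] alone, still with coboundary [f]. *)
Lemma coboundary_of_upset k m U f h : upset m U ->
    (forall s, size s = k -> (L s <= m)%MM -> h s != 0 -> U (L s)) ->
    (forall s, f s != 0 -> L s = m) ->
    (forall s, size s = k.+1 -> (L s <= m)%MM -> coboundary h s = f s) ->
    (forall m', (m' <= m)%MM -> U m' -> m' != m -> acyclic k m') ->
  exists h', (forall s, h' s != 0 -> L s = m) /\
    (forall s, size s = k.+1 -> L s = m -> f s = coboundary h' s).
Proof.
move=> upU supph suppf dh acyc.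
have [||h1 [supph1 eqh1]] := @retract_cochain k m U (pred1 m) h upU _ supph _ acyc.
- move=> m1 m2 /eqP -> le1 le2; apply/eqP; exact: lem_anti.
- by move=> s sz le_sm; rewrite dh // => /suppf ->; apply: eqxx.
exists (fun s => if L s == m then h s - coboundary h1 s else 0); split.
  by move=> s; case: (L s =P m) => // _; rewrite eqxx.
move=> s sz Ls; rewrite -dh ?Ls ?lepm_refl //.
transitivity (coboundary (fun t => h t - coboundary h1 t) s).
  by rewrite coboundaryB coboundaryK subr0.
apply: eq_coboundary => t sub_ts sz'; case: eqP => // neq.
apply/eqP; rewrite subr_eq0; apply: contraT => neqh; case: neq; apply/eqP.
apply: eqh1 neqh; last by rewrite -Ls lcm_word_subseq.
by apply/eqP; rewrite -eqSS -sz' sz.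
Qed.

Lemma upset_lcm m m0 : upset m (fun m' => mlcm m0 m' == m).
Proof.
move=> m1 m2 /eqP e1 le12 le2m; apply/eqP; apply: lem_anti.
  by rewrite lem_mlcm le2m -e1 lem_mlcml.
by rewrite -e1 lem_mlcm lem_mlcml (lepm_trans le12) ?lem_mlcmr.
Qed.

(** If the lcm of [s] properly divides [m], no deletion of [s] has lcm [m], so every term vanishes.
    The cocycle equation thus holds at [u :: s] without computing its lcm. *)
Lemma coboundary_of_cocycle k m f s : (forall s, f s != 0 -> L s = m) ->
    (forall s, size s = k.+1 -> L s = m -> coboundary f s = 0) ->
    size s = k.+1 -> (L s <= m)%MM -> coboundary f s = 0.
Proof.
move=> suppf df sz le_sm; have [Ls|neLs] := L s =P m; first exact: df.
apply/eqP; apply: contraT => /coboundary_support[t [sub_ts _ /suppf Lt]].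
by case: neLs; apply: lem_anti; rewrite // -Lt lcm_word_subseq.
Qed.

Lemma acyclic_step k m u : (g u <= m)%MM ->
    (forall m', mlcm (g u) m' = m -> acyclic k m') ->
  acyclic k.+1 m.
Proof.
move=> le_um acyc f suppf df; pose h s := f (u :: s).
apply: (@coboundary_of_upset k m (fun m' => mlcm (g u) m' == m) f h).
- exact: upset_lcm.
- by move=> s sz le_sm /suppf /= ->; apply: eqxx.
- exact: suppf.
(* The cocycle equation at [u :: s] reads [f s - coboundary h s = 0]. *)
- move=> s sz le_sm; apply/eqP; rewrite eq_sym -subr_eq0; apply/eqP.
  apply: (@coboundary_of_cocycle k.+1 m f (u :: s)) => //=; first by rewrite sz.
  by rewrite lem_mlcm le_um.
- by move=> m' _ /eqP /acyc.
Qed.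

End LcmCochains.

Lemma acyclic_deg_step (n : nat) (T : finType) (g : T -> 'X_{1..n})
    (K : fieldType) (d : nat) k m : (forall a, (mdeg (g a) <= d)%N) ->
    (forall m', (mdeg m <= mdeg m' + d)%N -> acyclic g K k m') ->
  acyclic g K k.+1 m.
Proof.
move=> deg_g acyc; case: (pickP (fun u => (g u <= m)%MM)) => [u le_u|none].
  apply: (acyclic_step le_u) => m' e; apply: acyc.
  by rewrite -e (leq_trans (mdeg_mlcm _ _)) // addnC leq_add2l.
(* If no generator divides [m], no nonempty word has lcm [m], and only nonempty words are tested. *)
move=> f suppf _; exists (fun=> 0); split=> [s|[//|u s] _ Ls].
  by rewrite eqxx.
by have := none u; rewrite -Ls /= lem_mlcml.
Qed.

(** A Mayer-Vietoris argument. The contractions of [f] with [u1] and [u2] both have coboundary [f]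
    and differ by the coboundary of [p]. Moving [p] into the union of their supporting upsets and
    splitting it there as [p1 - p2] turns both into one cochain on the intersection. *)
Lemma coboundary_upset_union (n : nat) (T : eqType) (g : T -> 'X_{1..n})
    (K : zmodType) k m (f : seq T -> K) u1 u2 (U : pred 'X_{1..n}) p q :
    (forall s, f s != 0 -> lcm_word g s = m) ->
    (forall s, size s = k.+3 -> lcm_word g s = m -> coboundary f s = 0) ->
    (g u1 <= m)%MM -> (g u2 <= m)%MM -> upset m U ->
    (forall s, size s = k -> (lcm_word g s <= m)%MM -> p s != 0 ->
       U (lcm_word g s)) ->
    (forall s, size s = k -> (lcm_word g s <= m)%MM ->
       f (u1 :: u2 :: s) = p s + coboundary q s) ->
    (forall m', (m' <= m)%MM -> U m' -> acyclic g K k m') ->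
    (forall m', mlcm (g u1) m' = m -> mlcm (g u2) m' = m -> m' != m ->
       acyclic g K k.+1 m') ->
  exists h, (forall s, h s != 0 -> lcm_word g s = m) /\
    (forall s, size s = k.+2 -> lcm_word g s = m -> f s = coboundary h s).
Proof.
set L := lcm_word g => suppf df le1 le2 upU suppp pE acyck acyck1.
pose P u : pred 'X_{1..n} := fun m' => mlcm (g u) m' == m.
have upP u : upset m (P u) by exact: upset_lcm.
pose h u s := f (u :: s).
have supph u s : h u s != 0 -> P u (L s) by move/suppf => e; apply/eqP.
have dh u s : (g u <= m)%MM -> size s = k.+2 -> (L s <= m)%MM ->
    coboundary (h u) s = f s.
  move=> le_u sz le_s; apply/eqP; rewrite eq_sym -subr_eq0; apply/eqP.
  apply: (@coboundary_of_cocycle n T g K k.+2 m f (u :: s)) => //=.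
    by rewrite sz.
  by rewrite lem_mlcm le_u.
(* This is [dh] for [u1] at the word [u2 :: s]; the term [coboundary q] has zero coboundary. *)
have dp s : size s = k.+1 -> (L s <= m)%MM -> coboundary p s = h u1 s - h u2 s.
  move=> sz le_s; transitivity (coboundary (fun t => h u1 (u2 :: t)) s).
    transitivity (coboundary (fun t => h u1 (u2 :: t) - coboundary q t) s).
      apply: eq_coboundary => t sub_ts; rewrite sz => -[szt].
      rewrite /h pE ?addrK // (lepm_trans _ le_s) //.
      exact: lcm_word_subseq.
    by rewrite coboundaryB coboundaryK subr0.
  have := dh u1 (u2 :: s) le1; rewrite /= sz lem_mlcm le2 le_s => /(_ erefl isT).
  by rewrite -/(h u2 s) => <-; rewrite opprB addrCA subrr addr0.
pose V : pred 'X_{1..n} := fun m' => P u1 m' || P u2 m'.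
have upV : upset m V.
  by move=> m1 m2 /orP[] Pm le12 le2m; apply/orP; [left|right]; apply: upP Pm _ _.
have [|m' le_m' Um' _|r [suppr eqr]] :=
    @retract_cochain n T g K k m U V p upU upV suppp.
- move=> s sz le_s; rewrite dp //; apply: contraR; rewrite negb_or => /andP[n1 n2].
  have /eqP-> : h u1 s == 0 by apply: contraNT n1; apply: supph.
  by rewrite sub0r oppr_eq0; apply: contraNT n2; apply: supph.
- exact: acyck.
(* What lies on [P u1] goes into [p1]; the remainder, which lies on [P u2], goes into [p2] with the
   opposite sign. *)
pose p1 s := if P u1 (L s) then p s - coboundary r s else 0.
pose p2 s := if P u1 (L s) then 0 else coboundary r s - p s.
have p1p2 s : p1 s - p2 s = p s - coboundary r s.
  by rewrite /p1 /p2; case: ifP => _; rewrite ?subr0 // sub0r opprB.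
pose h' s := h u1 s - coboundary p1 s.
have h'E s : size s = k.+1 -> (L s <= m)%MM -> h' s = h u2 s - coboundary p2 s.
  move=> sz le_s; have e : coboundary p1 s - coboundary p2 s = h u1 s - h u2 s.
    rewrite -coboundaryB -dp //.
    transitivity (coboundary (fun t => p t - coboundary r t) s).
      by apply: eq_coboundary => t _ _; rewrite p1p2.
    by rewrite coboundaryB coboundaryK subr0.
  rewrite /h' -[h u1 s](subrK (h u2 s)) -e [_ - _ + _]addrC -addrA.
  by congr (_ + _); rewrite addrAC subrr add0r.
apply: (@coboundary_of_upset n T g K k.+1 m (fun m' => P u1 m' && P u2 m') f h').
- move=> m1 m2 /andP[P1 P2] le12 le2m.
  by rewrite (upP u1 m1) // (upP u2 m1).
- have supp_sub u p0 s : (L s <= m)%MM ->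
      (forall t, size s = (size t).+1 -> (L t <= m)%MM -> p0 t != 0 -> P u (L t)) ->
      h u s - coboundary p0 s != 0 -> P u (L s).
    move=> le_s supp0; apply: contraR => nP.
    have /eqP-> : h u s == 0 by apply: contraNT nP; apply: supph.
    rewrite sub0r oppr_eq0; apply: contraNT nP.
    exact: (coboundary_upset (upP u)).
  move=> s sz le_s nz; apply/andP; split.
    apply: (supp_sub u1 p1) => // t _ _; rewrite /p1; case: (P u1 (L t)) => //.
    by rewrite eqxx.
  move: nz; rewrite h'E //; apply: supp_sub => // t; rewrite sz => -[szt] le_t.
  rewrite /p2; case: ifP => [_|nP1]; first by rewrite eqxx.
  rewrite subr_eq0 eq_sym => /(eqr _ (esym szt) le_t); rewrite /V nP1 //.
- exact: suppf.
- by move=> s sz le_s; rewrite coboundaryB coboundaryK subr0 dh.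
- by move=> m' _ /andP[/eqP e1 /eqP e2]; apply: acyck1.
Qed.

(** * Koszul syzygies and the step of two homological degrees *)

Section SyzygyStep.
Variables (n : nat) (T : finType) (g : T -> 'X_{1..n}) (K : fieldType).

Local Notation L := (lcm_word g).

(** Linear duality: a chain killed by all cocycles is a boundary. A 2-cocycle of multidegree [m] is
    the coboundary of some [h], and [h] vanishes on the one-letter words [u1] and [u2], whose lcm is
    not [m]; so the cocycle vanishes on the word [u1 u2]. *)
Lemma koszul_boundary u1 u2 (m := mlcm (g u1) (g u2)) :
    g u1 != m -> g u2 != m -> acyclic g K 2 m ->
  exists y : 3.-tuple T -> K, (forall w, y w != 0 -> L w = m) /\
    forall f : seq T -> K, (forall s, f s != 0 -> L s = m) ->
      f [:: u1; u2] = \sum_w y w * coboundary f w.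
Proof.
move=> ne1 ne2 acyc.
pose ix (t : 2.-tuple T) := enum_rank t.
pose w2 (j : 'I_#|{: 2.-tuple T}|) : 2.-tuple T := enum_val j.
pose w3 (i : 'I_#|{: 3.-tuple T}|) : 3.-tuple T := enum_val i.
pose fn (x : 'I_#|{: 2.-tuple T}| -> K) (s : seq T) : K :=
  \sum_j x j * ((s == w2 j) && (L s == m))%:R.
pose A : 'M[K]_(#|{: 3.-tuple T}|, #|{: 2.-tuple T}|) :=
  \matrix_(i, j) (coboundary (fn (fun j' => (j' == j)%:R)) (w3 i)
     *+ (L (w3 i) == m)).
have fnE x s : fn x s = \sum_j x j * fn (fun j' => (j' == j)%:R) s.
  rewrite /fn; apply: eq_bigr => j _; congr (_ * _).
  rewrite (bigD1 j) //= eqxx mul1r big1 ?addr0 // => j' /negPf ->.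
  by rewrite mul0r.
have supp_fn x s : fn x s != 0 -> L s = m.
  move=> nz; apply/eqP; apply: contraNT nz => /negPf ne; apply/eqP.
  by rewrite /fn big1 // => j _; rewrite ne andbF mulr0.
have fn_tuple x (t : 2.-tuple T) : L t = m -> fn x t = x (ix t).
  move=> Lt; rewrite /fn (bigD1 (ix t)) //= /w2 enum_rankK eqxx Lt eqxx mulr1.
  rewrite big1 ?addr0 // => j neq; case: eqP => [/val_inj e|]; last by rewrite mulr0.
  by case/eqP: neq; rewrite /ix e /w2 enum_valK.
have cob_fn x (i : 3.-tuple T) : L i = m ->
    coboundary (fn x) i = \sum_j A (enum_rank i) j * x j.
  move=> Li; transitivity (\sum_j x j * coboundary (fn (fun j' => (j' == j)%:R)) i).
    transitivity (coboundary
        (fun t => \sum_j x j *: (fn (fun j' => (j' == j)%:R) t : K^o)) i).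
      by apply: eq_coboundary => t _ _; rewrite fnE.
    by rewrite coboundary_sum; apply: eq_bigr => j _; rewrite coboundaryZ.
  by apply: eq_bigr => j _; rewrite mxE /w3 enum_rankK Li eqxx mulr1n mulrC.
pose v : 'rV[K]_#|{: 2.-tuple T}| := delta_mx 0 (ix [tuple u1; u2]).
have Lu : L [:: u1; u2] = m by rewrite /= mlcm0.
(* [A] is the coboundary matrix in multidegree [m], so each column [x] of its cokernel gives a
   cocycle [fn x], whose value on the word [u1 u2] has to vanish. *)
have : (v <= A)%MS.
  rewrite submxE; apply/eqP/rowP => c; rewrite -rowE mxE [RHS]mxE.
  pose x j := cokermx A j c.
  have [||h [supph eqh]] := acyc (fn x).
  - exact: supp_fn.
  - move=> s sz Ls; pose i := Tuple (introT eqP sz).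
    rewrite (cob_fn x i) //.
    have := mulmx_coker A => /matrixP/(_ (enum_rank i) c); rewrite mxE => ->.
    by rewrite mxE.
  have := fn_tuple x [tuple u1; u2] Lu; rewrite /x => <-.
  rewrite (eqh [:: u1; u2]) //= !subr0.
  have /eqP-> : h [:: u2] == 0.
    by apply: contraNT ne2 => /supph /= <-; rewrite mlcm0.
  apply/eqP; rewrite sub0r oppr_eq0.
  by apply: contraNT ne1 => /supph /= <-; rewrite mlcm0.
case/submxP => y vE.
exists (fun w : 3.-tuple T => if L w == m then y 0 (enum_rank w) else 0); split.
  by move=> w; case: (L w =P m) => // _; rewrite eqxx.
move=> f suppf; pose x j := f (w2 j).
have ffn (s : seq T) : size s = 2 -> f s = fn x s.
  move=> sz; have [Ls|neL] := L s =P m.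
    pose t := Tuple (introT eqP sz).
    by rewrite (fn_tuple x t) // /x /ix /w2 enum_rankK.
  transitivity (0 : K); first by apply/eqP; apply: contraT => /suppf.
  by apply/esym/eqP; apply: contraT => /supp_fn.
rewrite ffn // (fn_tuple x [tuple u1; u2]) //.
transitivity ((v *m \col_j x j) 0 0).
  by rewrite -rowE !mxE.
rewrite vE -mulmxA mxE (reindex (@enum_rank _)) /=; last first.
  by exists enum_val => ? _; rewrite ?enum_rankK ?enum_valK.
apply: eq_bigr => w _; case: eqP => [Lw|neL].
  congr (_ * _); rewrite !mxE (eq_coboundary (f2 := fn x)); last first.
    by move=> t _; rewrite size_tuple => -[/esym /ffn].
  by rewrite cob_fn //; apply: eq_bigr => j _; rewrite !mxE.
rewrite mul0r !mxE big1 ?mulr0 // => j _.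
by rewrite !mxE /w3 enum_rankK; case: eqP neL => //; rewrite mulr0n mul0r.
Qed.

Variable d : nat.
Hypothesis deg_g : forall a, (mdeg (g a) <= d)%N.

Lemma acyclic_syzygy_step k m : (0 < d)%N -> (2 * d <= mdeg m)%N ->
    (forall m', (2 * d <= mdeg m')%N -> acyclic g K 2 m') ->
    (forall m', (mdeg m < mdeg m' + 2 * d)%N -> acyclic g K k m') ->
    (forall m', (mdeg m < mdeg m' + d)%N -> acyclic g K k.+1 m') ->
  acyclic g K k.+2 m.
Proof.
move=> d_gt0 le_2dm acyc2 acyck acyck1 f suppf df.
have [[s [szs fs]]|f0] := classic (exists s, size s = k.+2 /\ f s != 0); last first.
  exists (fun=> 0); split=> [s|s sz _]; first by rewrite eqxx.
  rewrite coboundary0; apply/eqP; apply: contraT => nz.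
  by case: f0; exists s.
have Ls := suppf _ fs.
case: s szs fs Ls => [//|u1 s] _ _ Ls.
have := lepm_refl m; rewrite -{1}Ls lem_lcm_word /= => /andP[le1 /allP le_s].
(* If all letters had the same monomial, [m] would be [g u1], of degree at most [d]. *)
have [|/hasPn eq_s] := boolP (has (fun u => g u != g u1) s); last first.
  have /lem_mdeg : (m <= g u1)%MM.
    rewrite -Ls lem_lcm_word /= lepm_refl; apply/allP => u /eq_s.
    by rewrite negbK => /eqP ->; apply: lepm_refl.
  have := deg_g u1; lia.
case/hasP => u2 /le_s le2 neq21.
(* If [mdeg m' + d <= mdeg m], counting degrees makes [m] the product of [m'] with [g u1] and also
   with [g u2], contradicting [neq21]. *)
have acyc_lcm m' : mlcm (g u1) m' = m -> mlcm (g u2) m' = m -> m' != m ->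
    acyclic g K k.+1 m'.
  move=> e1 e2 ne; apply: acyck1.
  have tight u : mlcm (g u) m' = m -> (mdeg m' + d <= mdeg m)%N -> m = (g u + m')%MM.
    move=> e le; apply: lem_mdeg_eq; last by rewrite mdegD; have := deg_g u; lia.
    by rewrite -e lem_mlcm lem_addr lem_addl.
  rewrite ltnNge; apply/negP => le.
  have := tight _ e1 le; rewrite (tight _ e2 le) => /eqP.
  by rewrite eqm_add2r (negPf neq21).
pose U : pred 'X_{1..n} := fun m' => (mdeg m < mdeg m' + 2 * d)%N.
have upU : upset m U.
  by move=> m1 m2 Um1 /lem_mdeg le12 _; rewrite /U (leq_trans Um1) ?leq_add2r.
suff [p [q [suppp pE]]] : exists p q,
    (forall s, size s = k -> (L s <= m)%MM -> p s != 0 -> U (L s)) /\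
    (forall s, size s = k -> (L s <= m)%MM ->
       f (u1 :: u2 :: s) = p s + coboundary q s).
  apply: (coboundary_upset_union suppf df le1 le2 upU suppp pE) => //.
  by move=> m' _; apply: acyck.
have lcm_cat w t : L (w ++ t) = mlcm (L w) (L t).
  apply: lem_anti; last first.
    by rewrite lem_mlcm !lcm_word_subseq ?prefix_subseq ?suffix_subseq.
  rewrite lem_lcm_word all_cat -!lem_lcm_word lem_mlcml; exact: lem_mlcmr.
set m0 := mlcm (g u1) (g u2).
have deg_m0 : (mdeg m0 <= 2 * d)%N.
  by rewrite (leq_trans (mdeg_mlcm _ _)) // mul2n -addnn leq_add.
have suppU w t : (mdeg (L w) < 2 * d)%N -> f (w ++ t) != 0 -> U (L t).
  move=> ltw /suppf; rewrite lcm_cat => e; rewrite /U.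
  by have := mdeg_mlcm (L w) (L t); rewrite e; lia.
(* Below degree [2 * d] the contraction with the word [u1 u2] already lives on [U]. Otherwise [m0]
   has degree exactly [2 * d], and the word is replaced by a boundary. *)
have [lt|ge] := ltnP (mdeg m0) (2 * d).
  exists (fun s => f (u1 :: u2 :: s)), (fun=> 0); split=> [t _ _|t _ _].
    by apply: (suppU [:: u1; u2]); rewrite /= mlcm0.
  by rewrite coboundary0 addr0.
have ne u : g u != m0.
  by apply: contraTneq ge => <-; have := deg_g u; lia.
have [y [suppy yE]] := koszul_boundary (ne u1) (ne u2) (acyc2 _ ge).
(* The boundary formula needs cochains of multidegree [m0], so the other words are split off as
   [rest]. Among the deletions of [w] these have lcm of degree below [2 * d], so their contribution
   [p] lives on [U]; the full contraction yields the coboundary of [q]. *)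
pose rest t w := if L w == m0 then 0 else f (w ++ t).
exists (fun t => - \sum_w y w * coboundary (rest t) w).
exists (fun t => \sum_w y w * f (w ++ t)); split=> t szt le_t.
  rewrite oppr_eq0; apply: contraR => nU; rewrite big1 // => w _.
  have [->|/suppy Lw] := eqVneq (y w) 0; first by rewrite mul0r.
  suff /eqP-> : coboundary (rest t) w == 0 by rewrite mulr0.
  apply: contraNT nU.
  case/coboundary_support => w' [sub_w _]; rewrite /rest.
  case: (L w' =P m0) => [_|ne']; first by rewrite eqxx.
  have le_w : (L w' <= m0)%MM by rewrite -[m0]Lw lcm_word_subseq.
  apply: suppU; rewrite (leq_trans _ deg_m0) // ltnNge; apply/negP.
  by move/(lem_mdeg_eq le_w).
have -> : f (u1 :: u2 :: t) =
    \sum_w y w * coboundary (fun w' => f (w' ++ t) - rest t w') w.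
  rewrite -(yE (fun w' => f (w' ++ t) - rest t w')).
    by rewrite /rest /= mlcm0 eqxx subr0.
  move=> w; rewrite /rest; case: (L w =P m0) => //; by rewrite subrr eqxx.
rewrite coboundary_sum -sumrN -big_split /=; apply: eq_bigr => w _.
have [->|/suppy Lw] := eqVneq (y w) 0.
  rewrite !mul0r oppr0 add0r -[LHS](coboundary0 _ t).
  by apply: eq_coboundary => ? _ _; rewrite mul0r.
rewrite (coboundaryZ (y w) (fun t' => f (w ++ t') : K^o)).
rewrite coboundaryB mulrBr addrC; congr (_ + _); congr (_ * _).
have := coboundary_of_cocycle suppf df (s := w ++ t).
rewrite size_cat size_tuple szt lcm_cat lem_mlcm le_t andbT Lw => /(_ erefl).
rewrite lem_mlcm le1 le2 => /(_ isT).
(* Since [w] has three letters, the sign in the Leibniz rule is -1, and the cocycle equation at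
   [w ++ t] equates the two coboundaries. *)
rewrite coboundary_cat size_tuple -signr_odd /= expr1 mulrN1z => /eqP.
by rewrite subr_eq0 => /eqP.
Qed.

End SyzygyStep.

(** * Independence of Betti numbers from the resolution *)

Section HomogeneousMatrices.
Variables (n : nat) (K : fieldType).
Local Notation S := {mpoly K[n]}.

Lemma mcoeff_pihomog D (p : S) m :
  (pihomog mdeg D p)@_m = if mdeg m == D then p@_m else 0.
Proof.
rewrite pihomogE raddf_sum /=.
have [mp|mp] := boolP (m \in msupp p); last first.
  rewrite memN_msupp_eq0 // if_same big_seq_cond big1 // => k /andP[kp _].
  by rewrite mcoeffZ mcoeffX; case: eqP mp kp => [-> /negPf -> //|]; rewrite mulr0.
case: eqP => [mD|mD].
  rewrite big_mkcond (bigD1_seq m) ?msupp_uniq //= mD eqxx mcoeffZ mcoeffX.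
  rewrite eqxx mulr1 big1 ?addr0 // => k /negPf kn.
  by rewrite mcoeffZ mcoeffX kn mulr0 if_same.
rewrite big1 // => k /eqP kD; rewrite mcoeffZ mcoeffX.
by case: eqP kD mD => [->//|]; rewrite mulr0.
Qed.

(* The total degree of the monomial [m] in the entry of column [j] is
   [mdeg m + dc j]. *)
Definition mx_supp p q (P : 'I_p -> pred nat) (dc : 'I_q -> nat)
    (M : 'M[S]_(p, q)) : Prop :=
  forall i j m, m \in msupp (M i j) -> P i (mdeg m + dc j)%N.

Definition mx_homog p q (dr : 'I_p -> nat) (dc : 'I_q -> nat) :=
  mx_supp (fun i => pred1 (dr i)) dc.

Lemma mx_suppB p q P dc (M N : 'M[S]_(p, q)) :
  mx_supp P dc M -> mx_supp P dc N -> mx_supp P dc (M - N).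
Proof.
move=> hM hN i j m; rewrite !mxE => /msuppB_le; rewrite mem_cat.
by case/orP => [/hM|/hN].
Qed.

Lemma mx_supp_mul p q r P ds dc (M : 'M[S]_(p, q)) (N : 'M[S]_(q, r)) :
  mx_supp P ds M -> mx_homog ds dc N -> mx_supp P dc (M *m N).
Proof.
move=> hM hN i k m; rewrite mxE => mS.
have [j] : exists j, m \in msupp (M i j * N j k).
  apply/existsP; apply: contraLR mS; rewrite negb_exists => /forallP no.
  rewrite -mcoeff_eq0 raddf_sum big1 // => j _; apply/eqP.
  by rewrite mcoeff_eq0.
move/msuppM_le => /allpairsP[[m1 m2] /= [/hM P1 /hN /eqP e2 ->]].
by rewrite mdegD -addnA e2.
Qed.

Lemma mx_homog1 p (dc : 'I_p -> nat) : mx_homog dc dc 1%:M.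
Proof.
move=> i j m; rewrite mxE; case: eqP => [->|_]; last by rewrite msupp0.
by rewrite mulr1n msupp1 inE => /eqP ->; rewrite mdeg0 add0n /= eqxx.
Qed.

(** The guard matters: for [dr i < dc j] the truncated difference is 0, and constants would be
    kept. *)
Definition homog_part p q (dr : 'I_p -> nat) (dc : 'I_q -> nat)
    (N : 'M[S]_(p, q)) : 'M[S]_(p, q) :=
  \matrix_(i, j) (if (dc j <= dr i)%N then pihomog mdeg (dr i - dc j) (N i j)
                  else 0).

Lemma mcoeff_homog_part p q dr dc (N : 'M[S]_(p, q)) i j m :
  (homog_part dr dc N i j)@_m =
    if (mdeg m + dc j == dr i)%N then (N i j)@_m else 0.
Proof.
rewrite mxE; case: leqP => le; last first.
  by rewrite mcoeff0; case: eqP le => // <-; lia.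
by rewrite mcoeff_pihomog -(eqn_add2r (dc j)) subnK.
Qed.

Lemma homog_part_homog p q dr dc (N : 'M[S]_(p, q)) :
  mx_homog dr dc (homog_part dr dc N).
Proof.
move=> i j m; rewrite mcoeff_msupp mcoeff_homog_part /=.
by case: ifP => [//|_]; rewrite eqxx.
Qed.

Lemma homog_partC p q dr dc (N : 'M[S]_(p, q)) :
  mx_supp (fun i => predC1 (dr i)) dc (N - homog_part dr dc N).
Proof.
move=> i j m; rewrite mcoeff_msupp mxE [X in _ + X]mxE mcoeffB.
rewrite mcoeff_homog_part /=.
by case: ifP => [_|/negbT//]; rewrite subrr eqxx.
Qed.

(** The difference of the two sides lives in the row degrees [dr] and also away from them, so it is
    zero. Hence lifts of homogeneous matrices can be made homogeneous. *)
Lemma homog_part_mul p q r dr ds dc (M : 'M[S]_(p, r)) (N : 'M[S]_(p, q))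
    (D : 'M[S]_(q, r)) :
    mx_homog dr dc M -> mx_homog ds dc D -> M = N *m D ->
  M = homog_part dr ds N *m D.
Proof.
move=> hM hD eM; apply/eqP; rewrite -subr_eq0; apply/eqP/matrixP => i k.
have h1 : mx_homog dr dc (M - homog_part dr ds N *m D).
  exact: mx_suppB (mx_supp_mul (@homog_part_homog _ _ _ _ _) hD).
have h2 : mx_supp (fun i => predC1 (dr i)) dc (M - homog_part dr ds N *m D).
  by rewrite {1}eM -mulmxBl; apply: mx_supp_mul hD; apply: homog_partC.
rewrite [RHS]mxE; apply/mpolyP => m; rewrite mcoeff0; apply/eqP.
rewrite mcoeff_eq0; apply/negP => mS.
by have /negP := h2 _ _ _ mS; apply; apply: h1 mS.
Qed.

Lemma mx_homog_const p q dr dc (M : 'M[S]_(p, q)) j :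
    mx_homog dr dc M ->
  diag_mx (\row_c (dr c == j)%:R) *m map_mx (mcoeff 0%MM) M =
  map_mx (mcoeff 0%MM) M *m diag_mx (\row_c (dc c == j)%:R).
Proof.
move=> hM; apply/matrixP => i k; rewrite mul_diag_mx mul_mx_diag !mxE.
have [->|] := eqVneq (M i k)@_0 0; first by rewrite mulr0 mul0r.
by rewrite -mcoeff_msupp => /hM /eqP <-; rewrite mdeg0 add0n mulrC.
Qed.

End HomogeneousMatrices.

(** * Comparison maps between graded free resolutions *)

Section Comparison.
Variables (n : nat) (K : fieldType) (R : lmodType {mpoly K[n]}).
Variable pi : {linear {mpoly K[n]}^o -> R}.
Local Notation S := {mpoly K[n]}.

Section Lifting.
Variable F : graded_free_resolution pi.

Lemma gr_diff_mx_homog i :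
  mx_homog (@gr_deg _ _ _ _ F i.+1) (@gr_deg _ _ _ _ F i) (gr_diff F i).
Proof. by move=> r c m /gr_diff_homog /eqP. Qed.

Lemma gr_diffK i : gr_diff F i.+1 *m gr_diff F i = 0.
Proof.
apply/row_matrixP => k; rewrite row_mul row0; apply/gr_diff_exact.
by exists (delta_mx 0 k); rewrite -rowE.
Qed.

Lemma gr_aug_diff u : gr_aug F (u *m gr_diff F 0) = 0.
Proof. by apply/gr_aug_exact; exists u. Qed.

Lemma gr_diff_lift i p dr (M : 'M[S]_(p, gr_rank F i.+1)) :
    mx_homog dr (@gr_deg _ _ _ _ F i.+1) M -> M *m gr_diff F i = 0 ->
  exists N, mx_homog dr (@gr_deg _ _ _ _ F i.+2) N /\ M = N *m gr_diff F i.+1.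
Proof.
move=> hM M0; have /fin_all_exists[v vE] : forall k : 'I_p, exists v,
    row k M = v *m gr_diff F i.+1.
  by move=> k; apply/gr_diff_exact; rewrite -row_mul M0 row0.
exists (homog_part dr (@gr_deg _ _ _ _ F i.+2) (\matrix_k v k)).
split; first exact: homog_part_homog.
apply: homog_part_mul hM (@gr_diff_mx_homog _) _.
by apply/row_matrixP => k; rewrite row_mul rowK vE.
Qed.

Lemma gr_aug_lift p dr (M : 'M[S]_(p, gr_rank F 0)) :
    mx_homog dr (@gr_deg _ _ _ _ F 0) M ->
    (forall k, gr_aug F (row k M) = 0) ->
  exists N, mx_homog dr (@gr_deg _ _ _ _ F 1) N /\ M = N *m gr_diff F 0.
Proof.
move=> hM M0; have /fin_all_exists[v vE] : forall k : 'I_p, exists v,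
    row k M = v *m gr_diff F 0.
  by move=> k; apply/gr_aug_exact.
exists (homog_part dr (@gr_deg _ _ _ _ F 1) (\matrix_k v k)).
split; first exact: homog_part_homog.
apply: homog_part_mul hM (@gr_diff_mx_homog _) _.
by apply/row_matrixP => k; rewrite row_mul rowK vE.
Qed.

Lemma gr_augE : exists f : 'M[S]_(gr_rank F 0, 1),
  mx_homog (@gr_deg _ _ _ _ F 0) (fun=> 0%N) f /\
  forall u, gr_aug F u = pi ((u *m f) 0 0).
Proof.
have /fin_all_exists[f fP] := @gr_aug_homog _ _ _ _ F.
exists (\col_c f c); split=> [c j m|u].
  rewrite mxE; have [/dhomogP hf _] := fP c.
  by move=> /hf e; rewrite addn0 /=; apply/eqP.
rewrite {1}[u]row_sum_delta mxE !raddf_sum; apply: eq_bigr => c _.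
have [_ e] := fP c; rewrite mxE.
transitivity (u 0 c *: pi (f c)); last first.
  exact/esym/(linearZ_LR pi (u 0 c) (f c)).
rewrite -e; exact: (linearZ_LR (gr_aug F)).
Qed.

End Lifting.

Hypothesis pi_homog : forall f D, pi f = 0 -> pi (pihomog mdeg D f) = 0.

(** Arbitrary preimages are replaced by their homogeneous parts, which remain preimages because the
    kernel of [pi] is stable under taking homogeneous components. *)
Lemma gr_aug_homog_lift (F : graded_free_resolution pi) p dr
    (f : 'M[S]_(p, 1)) : mx_homog dr (fun=> 0%N) f ->
  exists N, mx_homog dr (@gr_deg _ _ _ _ F 0) N /\
    forall k, gr_aug F (row k N) = pi (f k 0).
Proof.
move=> hf; have [fF [hF augE]] := gr_augE F.
have /fin_all_exists[v vE] : forall k, exists v, gr_aug F v = pi (f k 0).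
  by move=> k; apply: gr_aug_surj.
pose N := \matrix_k v k.
exists (homog_part dr (@gr_deg _ _ _ _ F 0) N); split=> [|k].
  exact: homog_part_homog.
set N' := homog_part _ _ N.
have hN' : mx_homog dr (fun=> 0%N) (N' *m fF).
  exact: mx_supp_mul (@homog_part_homog _ _ _ _ _ _ _) hF.
have hC : mx_supp (fun i => predC1 (dr i)) (fun=> 0%N) ((N - N') *m fF).
  exact: mx_supp_mul (@homog_partC _ _ _ _ _ _ _) hF.
rewrite augE -row_mul mxE.
have e0 : pi ((N *m fF) k 0 - f k 0) = 0.
  by rewrite raddfB /= -vE augE -[v k](rowK v) -row_mul [_ 0 0]mxE subrr.
have := pi_homog (dr k) e0.
suff -> : pihomog mdeg (dr k) ((N *m fF) k 0 - f k 0) = (N' *m fF) k 0 - f k 0.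
  by rewrite raddfB => /eqP; rewrite subr_eq0 => /eqP.
apply/mpolyP => m; rewrite mcoeff_pihomog !mcoeffB.
have -> : N *m fF = N' *m fF + (N - N') *m fF by rewrite -mulmxDl addrC subrK.
rewrite [(_ + (N - N') *m fF) k 0]mxE mcoeffD.
case: (mdeg m =P dr k) => [e|ne].
  suff /eqP -> : (((N - N') *m fF) k 0)@_m == 0 by rewrite addr0.
  rewrite mcoeff_eq0; apply/negP => /hC /=.
  by rewrite addn0 e eqxx.
have /eqP-> : (f k 0)@_m == 0.
  by rewrite mcoeff_eq0; apply/negP => /hf /eqP; rewrite addn0.
have /eqP-> : ((N' *m fF) k 0)@_m == 0.
  by rewrite mcoeff_eq0; apply/negP => /hN' /eqP; rewrite addn0.
by rewrite subrr.
Qed.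

Lemma gr_aug_comparison (F G : graded_free_resolution pi) :
  exists phi, mx_homog (@gr_deg _ _ _ _ F 0) (@gr_deg _ _ _ _ G 0) phi /\
    forall u, gr_aug G (u *m phi) = gr_aug F u.
Proof.
have [f [hf augE]] := gr_augE F.
have [phi [hphi phiE]] := gr_aug_homog_lift G hf.
exists phi; split=> // u; rewrite augE [u *m phi]mulmx_sum_row [in RHS]mxE.
rewrite !raddf_sum; apply: eq_bigr => c _ /=.
transitivity (u 0 c *: pi (f c 0)); last first.
  exact/esym/(linearZ_LR pi (u 0 c) (f c 0)).
rewrite -phiE; exact: (linearZ_LR (gr_aug G)).
Qed.

(* The chain maps F -> G -> F and the homotopy from their composite to the
   identity, in the degrees needed for Tor_{i+1}. *)
Definition comparison_at (F G : graded_free_resolution pi) i : Prop :=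
  exists phi phi' psi psi' h,
    [/\ mx_homog (@gr_deg _ _ _ _ F i) (@gr_deg _ _ _ _ G i) phi,
        mx_homog (@gr_deg _ _ _ _ F i.+1) (@gr_deg _ _ _ _ G i.+1) phi',
        mx_homog (@gr_deg _ _ _ _ G i) (@gr_deg _ _ _ _ F i) psi,
        mx_homog (@gr_deg _ _ _ _ G i.+1) (@gr_deg _ _ _ _ F i.+1) psi' &
        mx_homog (@gr_deg _ _ _ _ F i) (@gr_deg _ _ _ _ F i.+1) h] /\
    [/\ phi' *m gr_diff G i = gr_diff F i *m phi,
        psi' *m gr_diff F i = gr_diff G i *m psi &
        gr_diff F i *m (phi *m psi - 1%:M - h *m gr_diff F i) = 0].

Lemma mx_homog_mul p q r dr ds dc (M : 'M[S]_(p, q)) (N : 'M[S]_(q, r)) :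
  mx_homog dr ds M -> mx_homog ds dc N -> mx_homog dr dc (M *m N).
Proof. exact: mx_supp_mul. Qed.

(** The usual homotopy relation also involves the homotopy one degree lower. Multiplying by
    [gr_diff F i] on the left kills that term, so the hypothesis has the same form for [i = 0]. *)
Lemma comparison_step (F G : graded_free_resolution pi) i phi' psi'
    (h : 'M_(gr_rank F i, gr_rank F i.+1))
    (phi : 'M_(gr_rank F i, gr_rank G i)) psi :
    mx_homog (@gr_deg _ _ _ _ F i.+1) (@gr_deg _ _ _ _ G i.+1) phi' ->
    mx_homog (@gr_deg _ _ _ _ G i.+1) (@gr_deg _ _ _ _ F i.+1) psi' ->
    mx_homog (@gr_deg _ _ _ _ F i) (@gr_deg _ _ _ _ F i.+1) h ->
    phi' *m gr_diff G i = gr_diff F i *m phi ->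
    psi' *m gr_diff F i = gr_diff G i *m psi ->
    gr_diff F i *m (phi *m psi - 1%:M - h *m gr_diff F i) = 0 ->
  exists phi'' psi'' h',
    [/\ mx_homog (@gr_deg _ _ _ _ F i.+2) (@gr_deg _ _ _ _ G i.+2) phi'',
        mx_homog (@gr_deg _ _ _ _ G i.+2) (@gr_deg _ _ _ _ F i.+2) psi'' &
        mx_homog (@gr_deg _ _ _ _ F i.+1) (@gr_deg _ _ _ _ F i.+2) h'] /\
    [/\ phi'' *m gr_diff G i.+1 = gr_diff F i.+1 *m phi',
        psi'' *m gr_diff F i.+1 = gr_diff G i.+1 *m psi' &
        phi' *m psi' - 1%:M = gr_diff F i *m h + h' *m gr_diff F i.+1].
Proof.
move=> hphi' hpsi' hh ephi epsi eh.
have [||phi'' [hphi'' phiE]] :=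
  @gr_diff_lift G i _ (@gr_deg _ _ _ _ F i.+2) (gr_diff F i.+1 *m phi').
- exact: mx_homog_mul (@gr_diff_mx_homog _ _) hphi'.
- by rewrite -mulmxA ephi mulmxA gr_diffK mul0mx.
have [||psi'' [hpsi'' psiE]] :=
  @gr_diff_lift F i _ (@gr_deg _ _ _ _ G i.+2) (gr_diff G i.+1 *m psi').
- exact: mx_homog_mul (@gr_diff_mx_homog _ _) hpsi'.
- by rewrite -mulmxA epsi mulmxA gr_diffK mul0mx.
have [||h' [hh' hE]] := @gr_diff_lift F i _ (@gr_deg _ _ _ _ F i.+1)
  (phi' *m psi' - 1%:M - gr_diff F i *m h).
- apply: mx_suppB; last exact: mx_homog_mul (@gr_diff_mx_homog _ _) hh.
  apply: mx_suppB; last exact: mx_homog1.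
  exact: mx_homog_mul hphi' hpsi'.
- move: eh; rewrite !mulmxBr !mulmxBl mulmx1 mul1mx => <-.
  by rewrite -mulmxA epsi !mulmxA ephi.
exists phi'', psi'', h'; split=> //; split=> //.
by rewrite -hE [RHS]addrC subrK.
Qed.

Lemma comparison (F G : graded_free_resolution pi) i : comparison_at F G i.
Proof.
elim: i => [|i [phi [phi' [psi [psi' [h [[H1 H2 H3 H4 H5] [E1 E2 E3]]]]]]]].
  have [phi [hphi phiE]] := gr_aug_comparison F G.
  have [psi [hpsi psiE]] := gr_aug_comparison G F.
  have [||phi' [hphi' ephi']] := @gr_aug_lift G _ (@gr_deg _ _ _ _ F 1)
    (gr_diff F 0 *m phi).
  - exact: mx_homog_mul (@gr_diff_mx_homog _ _) hphi.
  - by move=> k; rewrite row_mul phiE rowE gr_aug_diff.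
  have [||psi' [hpsi' epsi']] := @gr_aug_lift F _ (@gr_deg _ _ _ _ G 1)
    (gr_diff G 0 *m psi).
  - exact: mx_homog_mul (@gr_diff_mx_homog _ _) hpsi.
  - by move=> k; rewrite row_mul psiE rowE gr_aug_diff.
  have [||h [hh hE]] := @gr_aug_lift F _ (@gr_deg _ _ _ _ F 0)
    (phi *m psi - 1%:M).
  - apply: mx_suppB; last exact: mx_homog1.
    exact: mx_homog_mul hphi hpsi.
  - move=> k; rewrite linearB /= raddfB /= row_mul psiE rowE phiE.
    by rewrite row1 subrr.
  by exists phi, phi', psi, psi', h; rewrite hE subrr mulmx0.
have [phi'' [psi'' [h' [[H6 H7 H8] [E4 E5 E6]]]]] :=
  comparison_step H2 H4 H5 E1 E2 E3.
exists phi', phi'', psi', psi'', h'; split=> //; split=> //.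
by rewrite E6 addrK mulmxA gr_diffK mul0mx.
Qed.

Section Betti.
Variable F : graded_free_resolution pi.

Lemma tensor_degree_diff i j :
  tensor_degree F i.+1 j *m tensor_diff F i =
  tensor_diff F i *m tensor_degree F i j.
Proof. exact: mx_homog_const (@gr_diff_mx_homog F i). Qed.

Lemma tensor_degree_idem i j :
  tensor_degree F i j *m tensor_degree F i j = tensor_degree F i j.
Proof.
rewrite mulmx_diag; congr diag_mx; apply/rowP => c; rewrite !mxE.
by case: eqP => _; rewrite ?mulr1 ?mulr0.
Qed.

Lemma tensor_diffK i : tensor_diff F i.+1 *m tensor_diff F i = 0.
Proof. by rewrite /tensor_diff -map_mxM gr_diffK map_mx0. Qed.

(** [w] need not have degree [j]: projection to degree [j] commutes with the differential, so any
    preimage of a homogeneous [v] can be projected. *)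
Lemma betti_neq0P i j : betti F i.+1 j <> 0%N <->
  exists v : 'rV_(gr_rank F i.+1), [/\ v *m tensor_degree F i.+1 j = v,
    v *m tensor_diff F i = 0 & forall w, v <> w *m tensor_diff F i.+1].
Proof.
set Z := tensor_cycles F i.+1 j; set B := tensor_boundaries F i.+1 j.
have leBZ : (B <= Z)%MS.
  rewrite sub_capmx; apply/andP; split.
    by rewrite /B /tensor_boundaries tensor_degree_diff submxMl.
  by rewrite sub_kermx /B /tensor_boundaries -mulmxA tensor_diffK mulmx0.
have inZ (v : 'rV_(gr_rank F i.+1)) : (v <= Z)%MS <->
    v *m tensor_degree F i.+1 j = v /\ v *m tensor_diff F i = 0.
  rewrite sub_capmx sub_kermx; split=> [/andP[/submxP[w ->] /eqP e]|[e1 e2]].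
    by rewrite -mulmxA tensor_degree_idem.
  by rewrite -{1}e1 submxMl e2 eqxx.
have inB (v : 'rV_(gr_rank F i.+1)) : v *m tensor_degree F i.+1 j = v ->
    (v <= B)%MS <-> exists w, v = w *m tensor_diff F i.+1.
  move=> vD; split=> [/submxP[w ->]|[w e]].
    by exists (w *m tensor_degree F i.+2 j); rewrite -mulmxA.
  rewrite -vD e -mulmxA -tensor_degree_diff; exact: submxMl.
have -> : betti F i.+1 j <> 0%N <-> ~~ (Z <= B)%MS.
  rewrite /betti -/Z -/B; split=> [nz|]; last first.
    rewrite -(geq_leqif (mxrank_leqif_sup leBZ)) -ltnNge -subn_gt0 => lt e.
    by rewrite e in lt.
  by apply/negP => /mxrankS le; case: nz; apply/eqP; rewrite subn_eq0.
split=> [/row_subPn[k nB]|[v [v1 v2 v3]]].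
  have /inZ[e1 e2] := row_sub k Z; exists (row k Z); split=> // w e.
  by case/negP: nB; apply/(inB _ e1); exists w.
apply/negP => le; have /(submx_trans)/(_ le) : (v <= Z)%MS by apply/inZ.
by case/(inB _ v1) => w; apply: v3.
Qed.

End Betti.

(** Maximal shifts depend only on which Betti numbers vanish, so it is enough to carry a cycle that
    is not a boundary along [phi']. *)
Lemma betti_neq0_transfer (F G : graded_free_resolution pi) i j :
  betti F i.+1 j <> 0%N -> betti G i.+1 j <> 0%N.
Proof.
move=> /betti_neq0P[v [vD vd vB]].
have [phi [phi' [psi [psi' [h [[H1 H2 H3 H4 H5] [E1 E2 E3]]]]]]] :=
  comparison F G i.
have [phi'' [psi'' [h' [[H6 H7 H8] [E4 E5 E6]]]]] :=
  comparison_step H2 H4 H5 E1 E2 E3.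
pose c p q (M : 'M[S]_(p, q)) := map_mx (mcoeff 0%MM) M.
apply/betti_neq0P; exists (v *m c _ _ phi'); split.
- by rewrite -mulmxA -(mx_homog_const _ H2) mulmxA vD.
- by rewrite -mulmxA -map_mxM E1 map_mxM mulmxA -/(tensor_diff F i) vd mul0mx.
(* If the image of [v] bounds [w], the homotopy exhibits [v] as the boundary of this vector. *)
move=> w e; case: (vB (w *m c _ _ psi'' - v *m c _ _ h')).
rewrite mulmxBl -!mulmxA /c -!map_mxM E5 (map_mxM _ (gr_diff G _)) mulmxA.
rewrite -/(tensor_diff G _) -e -mulmxA -map_mxM.
have -> : phi' *m psi' = 1%:M + (gr_diff F i *m h + h' *m gr_diff F i.+1).
  by rewrite -E6 addrC subrK.
rewrite !map_mxD map_mx1 !mulmxDr mulmx1 !map_mxM !mulmxA. 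
by rewrite [v *m map_mx _ (gr_diff F i)]vd mul0mx add0r addrK.
Qed.

End Comparison.

(** * The Taylor resolution on words *)

Section Taylor.
Variables (n : nat) (K : fieldType) (T : finType) (g : T -> 'X_{1..n}).
Local Notation S := {mpoly K[n]}.
Local Notation L := (lcm_word g).

(** The coefficient of [B] in the boundary of the word [A]; when repeated letters make several
    deletions agree, their signs add up. *)
Definition incidence (A B : seq T) : K := coboundary (fun w => (w == B)%:R) A.

Lemma incidence_subseq A B : incidence A B != 0 -> subseq B A.
Proof.
case/coboundary_support => w [sub_w _]; case: (w =P B) => [<-//|_].
by rewrite eqxx.
Qed.

Lemma coboundary_incidence i (f : seq T -> K) (A : seq T) : size A = i.+1 ->
  coboundary f A = \sum_(B : i.-tuple T) incidence A B * f B.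
Proof.
move=> szA; rewrite /incidence.
under eq_bigr => B _ do rewrite mulrC.
under eq_bigr => B _ do
  rewrite -[_ * _]/(f B *: (coboundary _ A : K^o)) -coboundaryZ.
rewrite -coboundary_sum; apply: eq_coboundary => t _; rewrite szA => -[szt].
pose B := Tuple (introT eqP (esym szt)).
rewrite (bigD1 B) //= eqxx big1 ?addr0 => [|B' ne].
  by rewrite -[_ *: _]/(_ * _) mulr1.
rewrite (_ : (t == B') = false) ?scaler0 //.
by apply: contraNF ne => /eqP e; apply/eqP/val_inj.
Qed.

Definition taylor_rank i := #|{: i.-tuple T}|.
Definition taylor_word i (r : 'I_(taylor_rank i)) : i.-tuple T := enum_val r.
Definition taylor_index i (A : i.-tuple T) : 'I_(taylor_rank i) := enum_rank A.

Lemma taylor_wordK i : cancel (@taylor_word i) (@taylor_index i).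
Proof. exact: enum_valK. Qed.
Lemma taylor_indexK i : cancel (@taylor_index i) (@taylor_word i).
Proof. exact: enum_rankK. Qed.

Lemma sum_taylor_word (V : nmodType) i (F : i.-tuple T -> V) :
  \sum_A F A = \sum_(r < taylor_rank i) F (taylor_word r).
Proof.
apply: reindex; exists (@taylor_index i) => ? _.
  exact: taylor_wordK.
exact: taylor_indexK.
Qed.

Definition taylor_diff i : 'M[S]_(taylor_rank i.+1, taylor_rank i) :=
  \matrix_(r, c) (incidence (taylor_word r) (taylor_word c)
     *: 'X_[L (taylor_word r) - L (taylor_word c)]).

(** The component of multidegree [mu], the basis element of the word [A] having multidegree [L A].
    It reduces exactness over the polynomial ring to linear algebra over [K]. *)
Definition strand i (v : 'rV[S]_(taylor_rank i)) (mu : 'X_{1..n})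
    (A : i.-tuple T) : K :=
  if (L A <= mu)%MM then (v 0 (taylor_index A))@_(mu - L A) else 0.

Lemma mcoeffMX_if (p : S) a b :
  (p * 'X_[a])@_b = if (a <= b)%MM then p@_(b - a) else 0.
Proof.
case: ifP => [le|/negP nle]; first by rewrite -{1}(submK le) addmC mcoeffMX.
apply/eqP; rewrite mcoeff_eq0; apply/negP => /msuppM_le.
case/allpairsP => -[m1 m2] /= [_]; rewrite msuppX inE => /eqP -> e.
by apply: nle; rewrite e lem_addl.
Qed.

Lemma lem_subLR (a b c : 'X_{1..n}) : (c <= a)%MM -> (c <= b)%MM ->
  (a - c <= b - c)%MM = (a <= b)%MM /\ (b - c - (a - c) = b - a)%MM.
Proof.
move=> /mnm_lepP le1 /mnm_lepP le2; split; last first.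
  by apply/mnmP => i; rewrite !mnmBE; have := le1 i; have := le2 i; lia.
apply/mnm_lepP/mnm_lepP => h i; move: (h i); rewrite !mnmBE;
  by have := le1 i; have := le2 i; lia.
Qed.

Lemma strand_diff i (v : 'rV_(taylor_rank i.+1)) mu (C : i.-tuple T) :
    (L C <= mu)%MM ->
  strand (v *m taylor_diff i) mu C =
    \sum_(A : i.+1.-tuple T) incidence A C * strand v mu A.
Proof.
move=> le_C; rewrite /strand le_C mxE sum_taylor_word raddf_sum.
apply: eq_bigr => r _ /=; rewrite mxE taylor_indexK taylor_wordK.
set A := taylor_word r; rewrite -scalerAr mcoeffZ mcoeffMX_if.
have [->|nz] := eqVneq (incidence A C) 0; first by rewrite !mul0r.
have le_CA := lcm_word_subseq g (incidence_subseq nz).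
by have [-> ->] := lem_subLR le_CA le_C.
Qed.

Lemma strand_inj i (v w : 'rV_(taylor_rank i)) :
  (forall mu (A : i.-tuple T), (L A <= mu)%MM ->
     strand v mu A = strand w mu A) -> v = w.
Proof.
move=> e; apply/rowP => r; apply/mpolyP => m.
have := e (m + L (taylor_word r))%MM (taylor_word r) (lem_addl _ _).
by rewrite /strand lem_addl taylor_wordK addmK.
Qed.

Lemma taylor_diffK i : taylor_diff i.+1 *m taylor_diff i = 0.
Proof.
apply/row_matrixP => k; rewrite rowE mulmxA row0; set w := delta_mx 0 k.
apply: strand_inj => mu C le_C; rewrite strand_diff // [RHS]/strand mxE mcoeff0 if_same.
transitivity (\sum_(B : i.+1.-tuple T) \sum_(A : i.+2.-tuple T)
    incidence A B * incidence B C * strand w mu A).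
  apply: eq_bigr => B _.
  have [->|nzBC] := eqVneq (incidence B C) 0.
    by rewrite mul0r big1 // => A _; rewrite mulr0 mul0r.
  have [le_B|nle_B] := boolP (L B <= mu)%MM.
    rewrite strand_diff // mulr_sumr; apply: eq_bigr => A _.
    by rewrite mulrA [incidence B C * _]mulrC.
  (* If the lcm of [B] does not divide [mu], neither does that of a word containing [B], so both
     sides vanish. *)
  rewrite /strand (negPf nle_B) mulr0 big1 // => A _.
  have [->|nzAB] := eqVneq (incidence A B) 0; first by rewrite !mul0r.
  rewrite ifN ?mulr0 //; apply: contra nle_B; apply: lepm_trans.
  exact: lcm_word_subseq (incidence_subseq nzAB).
rewrite exchange_big /= big1 // => A _.
rewrite -mulr_suml -(@coboundary_incidence _ (fun B => incidence B C)) ?size_tuple //.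
by rewrite /incidence coboundaryK mul0r.
Qed.

Definition divisor (mu : 'X_{1..n}) : option T := [pick a | (g a <= mu)%MM].

(* The contracting homotopy of the strand in multidegree [mu] prepends a chosen
   generator dividing [mu]. *)
Definition taylor_homotopy i (v : 'rV[S]_(taylor_rank i)) :
    'rV[S]_(taylor_rank i.+1) :=
  \row_(r < taylor_rank i.+1) (let A := taylor_word r in
    let p := v 0 (taylor_index [tuple of behead A]) in
    \sum_(m : 'X_{1..n < msize p})
      (if divisor (m + L A)%MM == Some (thead A)
       then p@_(m + L A - L (behead A)) else 0) *: 'X_[m]).

Lemma strand_homotopy i (v : 'rV[S]_(taylor_rank i)) mu (A : i.+1.-tuple T) :
  strand (taylor_homotopy v) mu A =
    if divisor mu == Some (thead A) then strand v mu (behead_tuple A) else 0.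
Proof.
rewrite /strand mxE taylor_indexK /=.
have LA : L A = mlcm (g (thead A)) (L (behead A)) by rewrite {1}(tuple_eta A).
set p := v 0 _; case: ifP => [le_A|/negP nle_A]; last first.
  case: ifP => // /eqP dmu; rewrite ifF //; apply/negP => le_B; case: nle_A.
  rewrite LA lem_mlcm le_B andbT.
  by move: dmu; rewrite /divisor; case: pickP => // a le_a [<-].
have le_BA : (L (behead A) <= L A)%MM by rewrite LA lem_mlcmr.
rewrite (lepm_trans le_BA le_A).
set m := (mu - L A)%MM; have e : (m + L A = mu)%MM by rewrite submK.
have [lt_m|ge_m] := ltnP (mdeg m) (msize p).
  by rewrite (mcoeff_mpoly (fun m => if divisor (m + L A)%MM == Some (thead A)
       then p@_(m + L A - L (behead A)) else 0)) // e.
(* Outside the range of the sum both sides vanish, since [mu - L (behead A)] has degree at least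
   that of [m]. *)
rewrite raddf_sum big1 => [|k _]; last first.
  rewrite /= mcoeffZ mcoeffX; case: (_ =P m) => [ek|_]; last by rewrite mulr0.
  by have := bmdeg k; rewrite ek ltnNge ge_m.
rewrite [p@__]memN_msupp_eq0 ?if_same //; apply/negP => /msize_mdeg_lt.
rewrite ltnNge (leq_trans ge_m) // lem_mdeg //.
apply/mnm_lepP => i0; rewrite !mnmBE leq_sub2l //.
exact/(mnm_lepP _).
Qed.

(** The boundary of [u :: B] is [B] minus the boundary of [B] with [u] prepended, and the second
    part cancels against a cycle. The condition [0 < i] makes the cycle hypothesis empty for the
    empty word. *)
Lemma taylor_homotopy_diff i (v : 'rV[S]_(taylor_rank i)) :
    (forall mu (A : i.-tuple T), strand v mu A != 0 -> divisor mu) ->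
    (forall mu (t : seq T), size t = i.-1 -> (L t <= mu)%MM -> (0 < i)%N ->
       \sum_(B : i.-tuple T) incidence B t * strand v mu B = 0) ->
  v = taylor_homotopy v *m taylor_diff i.
Proof.
move=> hdiv hcyc; apply: strand_inj => mu C le_C; rewrite strand_diff //.
under eq_bigr => A _ do rewrite strand_homotopy.
case dE: (divisor mu) => [u|]; last first.
  rewrite big1 => [|A _]; last by rewrite mulr0.
  by apply/eqP; apply: contraT => /hdiv; rewrite dE.
transitivity (\sum_(B : i.-tuple T) incidence (u :: B) C * strand v mu B).
  transitivity (\sum_(B : i.-tuple T) (B == C)%:R * strand v mu B -
      \sum_(B : i.-tuple T) coboundary (fun t => (u :: t == C)%:R) B * strand v mu B).
    rewrite (bigD1 C) //= eqxx mul1r big1 ?addr0; last first.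
      by move=> B /negPf ->; rewrite mul0r.
    rewrite -[LHS]subr0; congr (_ - _); apply/esym.
    case: i v hdiv hcyc C le_C => [|i] v hdiv hcyc C le_C.
      by rewrite big1 // => B _; rewrite (tuple0 B) /= mul0r.
    have [eu|neu] := u =P thead C; last first.
      rewrite big1 // => B _.
      rewrite (eq_coboundary (f2 := fun=> 0)) ?coboundary0 ?mul0r //.
      by move=> t _ _; case: eqP => // e; case: neu; rewrite /thead (tnth_nth u) -e.
    rewrite -[RHS](hcyc mu (behead C)) ?size_behead ?size_tuple //; last first.
      by apply: lepm_trans le_C; rewrite {2}(tuple_eta C) lem_mlcmr.
    apply: eq_bigr => B _; congr (_ * _); apply: eq_coboundary => t _ _.
    have {1}-> : tval C = thead C :: behead C by rewrite {1}(tuple_eta C).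
    by rewrite eqseq_cons eu eqxx.
  rewrite -sumrB; apply: eq_bigr => B _; rewrite -mulrBl; congr (_ * _).
rewrite (bigID (fun A : i.+1.-tuple T => thead A == u)) /= [X in _ + X]big1 ?addr0.
  rewrite (reindex_onto (fun B : i.-tuple T => [tuple of u :: B])
    (fun A => [tuple of behead A])) /=; last first.
    by move=> A /eqP <-; rewrite [RHS]tuple_eta; apply: val_inj.
  apply: eq_big => [B|B _]; last first.
    rewrite theadE eqxx; congr (_ * strand _ _ _); exact: val_inj.
  by rewrite theadE eqxx /=; apply/esym/eqP; apply: val_inj.
by move=> A /negPf ne; rewrite (inj_eq Some_inj) eq_sym ne mulr0.
Qed.

Variables (R : lmodType S) (pi : {linear S^o -> R}).
Hypothesis pi_surj : forall y, exists f, pi f = y.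
Hypothesis pi_ker : forall f, pi f = 0 <-> {in msupp f, forall m, divisor m}.

(** There is a single word of length 0, so the sum has one term; it avoids naming its index. *)
Definition taylor_aug (u : 'rV[S]_(taylor_rank 0)) : R := pi (\sum_c u 0 c).

Lemma taylor_aug_linear : linear taylor_aug.
Proof.
move=> a u v; rewrite /taylor_aug.
under eq_bigr => c _ do rewrite !mxE.
by rewrite big_split /= -mulr_sumr raddfD /= -(linearZ_LR pi).
Qed.

HB.instance Definition _ :=
  GRing.isLinear.Build S 'rV[S]_(taylor_rank 0) R _ taylor_aug taylor_aug_linear.

Lemma taylor_augE u : taylor_aug u = pi (u 0 (taylor_index [tuple])).
Proof.
rewrite /taylor_aug (bigD1 (taylor_index [tuple])) //= big1 ?addr0 // => c.
by case/eqP; rewrite -[c]taylor_wordK; congr taylor_index; apply: tuple0.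
Qed.

Lemma taylor_diff_homog i r c m : m \in msupp (taylor_diff i r c) ->
  (mdeg m + mdeg (L (taylor_word c)))%N = mdeg (L (taylor_word r)).
Proof.
rewrite mxE mcoeff_msupp mcoeffZ mcoeffX; case: (_ =P m) => [<-|_]; last first.
  by rewrite mulr0 eqxx.
rewrite mulr1 => /incidence_subseq /(lcm_word_subseq g) le.
by rewrite -mdegD submK.
Qed.

Lemma taylor_aug_homog c : exists f : S,
  f \is (mdeg (L (taylor_word c))).-homog /\ taylor_aug (delta_mx 0 c) = pi f.
Proof.
exists 1; rewrite [taylor_word c]tuple0 /= mdeg0 dhomog1; split=> //.
rewrite taylor_augE mxE -[c]taylor_wordK [taylor_word c]tuple0.
by rewrite !eqxx.
Qed.

Lemma taylor_aug_surj y : exists u, taylor_aug u = y.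
Proof.
have [f <-] := pi_surj y; exists (const_mx f).
by rewrite taylor_augE mxE.
Qed.

Lemma taylor_aug_exact u : taylor_aug u = 0 <-> exists v, u = v *m taylor_diff 0.
Proof.
rewrite taylor_augE; split=> [/pi_ker du|[v ->]].
  exists (taylor_homotopy u); apply: taylor_homotopy_diff => // mu A.
  rewrite /strand tuple0 /=; case: ifP => _; last by rewrite eqxx.
  rewrite -mcoeff_msupp => /du; rewrite (_ : _ - _ = mu)%MM //.
  by apply/mnmP => i; rewrite mnmBE mnm0E subn0.
apply/pi_ker => m; rewrite mcoeff_msupp => nz.
have le0 : (L [::] <= m)%MM by apply/mnm_lepP => i; rewrite mnm0E.
have := @strand_diff 0 v m [tuple] le0; rewrite {1}/strand le0.
rewrite (_ : _ - _ = m)%MM; last by apply/mnmP => i; rewrite mnmBE mnm0E subn0.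
move=> e; move: nz; rewrite e /divisor; case: pickP => //= none.
rewrite big1 ?eqxx // => A _; rewrite /strand ifF ?mulr0 //.
by rewrite {1}(tuple_eta A) /= lem_mlcm none.
Qed.

Lemma taylor_diff_exact i (u : 'rV_(taylor_rank i.+1)) :
  u *m taylor_diff i = 0 <-> exists v, u = v *m taylor_diff i.+1.
Proof.
split=> [u0|[v ->]]; last by rewrite -mulmxA taylor_diffK mulmx0.
exists (taylor_homotopy u); apply: taylor_homotopy_diff => [mu A|mu t szt le_t _].
  rewrite /strand; case: ifP => [|_]; last by rewrite eqxx.
  rewrite {1}(tuple_eta A) /= lem_mlcm /divisor => /andP[le_a _] _.
  by case: pickP => // /(_ (thead A)); rewrite le_a.
rewrite -(@strand_diff i u mu (Tuple (introT eqP szt))) // u0 /strand le_t.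
by rewrite mxE mcoeff0.
Qed.

Definition taylor : graded_free_resolution pi :=
  GradedFreeResolution (gr_aug := taylor_aug) taylor_diff_homog
    taylor_aug_homog taylor_aug_surj taylor_aug_exact taylor_diff_exact.

End Taylor.

(** * Betti numbers of the Taylor resolution *)

Section TaylorBetti.
Variables (n : nat) (K : fieldType) (T : finType) (g : T -> 'X_{1..n}).
Local Notation S := {mpoly K[n]}.
Local Notation L := (lcm_word g).
Variables (R : lmodType S) (pi : {linear S^o -> R}).
Hypothesis pi_surj : forall y, exists f, pi f = y.
Hypothesis pi_ker : forall f, pi f = 0 <-> {in msupp f, forall m, divisor g m}.

Local Notation F := (taylor pi_surj pi_ker).

Lemma tensor_taylorE i (r : 'I_(taylor_rank T i.+1)) (c : 'I_(taylor_rank T i)) :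
  tensor_diff F i r c = if L (taylor_word r) == L (taylor_word c)
    then incidence K (taylor_word r) (taylor_word c) else 0.
Proof.
rewrite !mxE mcoeffZ mcoeffX.
have [->|/incidence_subseq/(lcm_word_subseq g) le] :=
  eqVneq (incidence K (taylor_word r) (taylor_word c)) 0.
  by rewrite mul0r if_same.
rewrite (_ : (_ == 0%MM) = (L (taylor_word r) == L (taylor_word c))).
  by case: ifP => _; rewrite ?mulr1 ?mulr0.
apply/eqP/eqP => [e|->]; last first.
  by apply/mnmP => j; rewrite mnmBE subnn mnm0E.
by rewrite -(submK le) e add0m.
Qed.

Lemma tensor_taylor_mul i (f : seq T -> K) (r : 'I_(taylor_rank T i.+1))
    (m := L (taylor_word r)) :
    (forall s, f s != 0 -> L s = m) ->
  \sum_c tensor_diff F i r c * f (taylor_word c) = coboundary f (taylor_word r).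
Proof.
move=> suppf; rewrite (@coboundary_incidence _ _ i) ?size_tuple //.
rewrite sum_taylor_word; apply: eq_bigr => c _; rewrite tensor_taylorE.
have [->|/suppf Lc] := eqVneq (f (taylor_word c)) 0; first by rewrite !mulr0.
by rewrite Lc eqxx.
Qed.

(** Duality between homology of chains and cohomology of cochains, one multidegree at a time. In
    both directions membership in a row space is tested against a cokernel. *)
Lemma taylor_betti i j : betti F i.+1 j <> 0%N <->
  exists m, mdeg m = j /\ ~ acyclic g K i.+1 m.
Proof.
split=> [/betti_neq0P[v [vD vd vB]]|[m [dm nacyc]]].
  apply: NNPP => none; have acyc m : mdeg m = j -> acyclic g K i.+1 m.
    by move=> dm; apply: NNPP => na; case: none; exists m.
  have : ~~ (v <= tensor_diff F i.+1)%MS.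
    by apply/negP => /submxP[w]; apply: vB.
  rewrite submxE => /eqP nz; apply: nz; apply/rowP => c; rewrite mxE [RHS]mxE.
  set X := cokermx _; pose x r := X r c.
  have dx r : \sum_k tensor_diff F i.+1 r k * x k = 0.
    have := mulmx_coker (tensor_diff F i.+1) => /matrixP/(_ r c).
    by rewrite mxE [RHS]mxE.
  (* [f m] is the component of multidegree [m] of the cocycle [x]. Its primitives are glued into
     [H]; as [v] only sees degree [j], its pairing with [x] is that of its boundary with [H], which
     is 0. *)
  pose f m s := if (L s == m) then
    (if insub s is Some A then x (taylor_index (A : i.+1.-tuple T)) else 0)
    else 0.
  have fE m (k : 'I_(taylor_rank T i.+1)) :
      f m (taylor_word k) = if L (taylor_word k) == m then x k else 0.
    by rewrite /f valK taylor_wordK.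
  have suppf m s : f m s != 0 -> L s = m.
    by rewrite /f; case: (L s =P m) => // _; rewrite eqxx.
  have exh m : exists h, mdeg m = j -> (forall s, h s != 0 -> L s = m) /\
      forall s, size s = i.+1 -> L s = m -> f m s = coboundary h s.
    have [dm|] := mdeg m =P j; last by exists (fun=> 0).
    have [||h hP] := acyc m dm (f m); last by exists h.
    - exact: suppf.
    - move=> s szs Ls; pose A := Tuple (introT eqP szs).
      have e : taylor_word (taylor_index A) = A by exact: taylor_indexK.
      have := @tensor_taylor_mul i.+1 (f m) (taylor_index A).
      rewrite e => <-; last by move=> t; rewrite Ls; apply: suppf.
      rewrite -[RHS](dx (taylor_index A)); apply: eq_bigr => k _.
      rewrite tensor_taylorE e fE Ls eq_sym.
      by case: eqP => _; rewrite ?mulr0 ?mul0r.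
  pose h m := sval (constructive_indefinite_description _ (exh m)).
  have hP m : mdeg m = j -> (forall s, h m s != 0 -> L s = m) /\
      forall s, size s = i.+1 -> L s = m -> f m s = coboundary (h m) s.
    exact: (svalP (constructive_indefinite_description _ (exh m))).
  pose H : 'cV[K]_(taylor_rank T i) :=
    \col_k h (L (taylor_word k)) (taylor_word k).
  transitivity ((v *m tensor_diff F i *m H) 0 0); last by rewrite vd mul0mx mxE.
  rewrite -mulmxA mxE; apply: eq_bigr => r _.
  have [->|vr] := eqVneq (v 0 r) 0; first by rewrite !mul0r.
  have dr : mdeg (L (taylor_word r)) = j.
    apply/eqP; apply: contraNT vr => ne; rewrite -vD mul_mx_diag !mxE /=.
    by rewrite (negPf ne) mulr0.
  have [supph hE] := hP _ dr; congr (_ * _); transitivity (x r); first by [].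
  have := hE (taylor_word r); rewrite size_tuple fE eqxx => -> //.
  rewrite -tensor_taylor_mul // mxE; apply: eq_bigr => k _.
  rewrite tensor_taylorE [in RHS]mxE; case: eqP => [->//|_].
  by rewrite !mul0r.
apply: NNPP => b0; apply: nacyc => f suppf df.
pose x : 'cV[K]_(taylor_rank T i.+1) := \col_r f (taylor_word r).
have dx : tensor_diff F i.+1 *m x = 0.
  apply/colP => r; rewrite mxE [RHS]mxE.
  have [Lr|neL] := L (taylor_word r) =P m.
    rewrite -[RHS](df (taylor_word r)) ?size_tuple // -(@tensor_taylor_mul i.+1).
      by apply: eq_bigr => c _; rewrite [x c 0]mxE.
    by rewrite Lr.
  rewrite big1 // => c _; rewrite tensor_taylorE [x c 0]mxE.
  case: eqP => [e|_]; last by rewrite mul0r.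
  have [->|/suppf Lc] := eqVneq (f (taylor_word c)) 0; first by rewrite mulr0.
  by case: neL; rewrite e.
have [/submxP[w /(congr1 trmx) xE]|] :=
    boolP (x^T <= (tensor_diff F i)^T)%MS; last first.
  rewrite submxE; set X := cokermx _ => nz; case: b0.
  have [c nzc] : exists c, (x^T *m X) 0 c != 0.
    case: (pickP (fun c => (x^T *m X) 0 c != 0)) => [c nzc|none]; first by exists c.
    by case/eqP: nz; apply/rowP => c; rewrite [RHS]mxE; apply/eqP/negbFE/none.
  (* [v0] is a cycle pairing nontrivially with the cocycle [x]. Its degree [j] part has the same
     pairing, and is no boundary because [x] kills boundaries. *)
  pose v0 := (col c X)^T; pose D := tensor_degree F i.+1 j.
  have v0d : v0 *m tensor_diff F i = 0.
    apply: trmx_inj; rewrite trmx_mul trmxK colE mulmxA mulmx_coker.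
    by rewrite mul0mx trmx0.
  have Dx : D *m x = x.
    apply/colP => r; rewrite mul_diag_mx !mxE /=.
    have [->|/suppf ->] := eqVneq (f (taylor_word r)) 0; first by rewrite mulr0.
    by rewrite dm eqxx mul1r.
  have v0x : (v0 *m x) 0 0 != 0.
    by rewrite -[v0 *m x]trmxK trmx_mul trmxK mxE colE mulmxA -colE mxE.
  apply/betti_neq0P; exists (v0 *m D); split.
  - by rewrite /D -mulmxA (tensor_degree_idem F).
  - by rewrite /D -mulmxA (tensor_degree_diff F) mulmxA v0d mul0mx.
  move=> w e; case/eqP: v0x.
  by rewrite -Dx mulmxA e -mulmxA dx mulmx0 mxE.
move: xE; rewrite trmxK trmx_mul trmxK => xE.
pose h s := if L s == m then
    (if insub s is Some A then w 0 (taylor_index (A : i.-tuple T)) else 0)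
  else 0.
have supph s : h s != 0 -> L s = m.
  by rewrite /h; case: (L s =P m) => // _; rewrite eqxx.
exists h; split=> // s szs Ls; pose A := Tuple (introT eqP szs).
have e : taylor_word (taylor_index A) = A by exact: taylor_indexK.
have := @tensor_taylor_mul i h (taylor_index A); rewrite e => <-; last first.
  by move=> t /supph ->.
transitivity (x (taylor_index A) 0); first by rewrite mxE e.
rewrite xE mxE; apply: eq_bigr => k _; rewrite [w^T k 0]mxE !tensor_taylorE e.
rewrite /h valK taylor_wordK Ls eq_sym.
by case: eqP => _; rewrite ?mulr0 ?mul0r.
Qed.

End TaylorBetti.

(** * Maximal shifts of monomial ideals *)

Section MonomialQuotient.
Variables (n : nat) (K : fieldType) (I : {mpoly K[n]} -> Prop).
Hypothesis hI : monomial_ideal I.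
Variables (R : lmodType {mpoly K[n]}) (pi : {linear {mpoly K[n]}^o -> R}).
Hypothesis hR : quotient_map I pi.

Lemma quotient_mul0 (f h : {mpoly K[n]}) : pi h = 0 -> pi (f * h) = 0.
Proof. by move=> h0; rewrite [pi _](linearZ_LR pi f h) h0 scaler0. Qed.

Lemma quotient_monomial0 m m' : (m' <= m)%MM ->
  pi 'X_[m'] = 0 -> pi 'X_[m] = 0.
Proof. by move=> /submK <- h; rewrite mpolyXD quotient_mul0. Qed.

Lemma quotient_support f :
  pi f = 0 <-> {in msupp f, forall m, pi 'X_[m] = 0}.
Proof.
have [G GP] := hI; have [_ ker] := hR; split=> [/ker/GP[s [sG ->]] m|f0].
  move/msupp_sum_le/flattenP => [u /mapP[x]]; rewrite filter_predT => xs ->.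
  move/msuppM_le/allpairsP => [[m1 m2] /= [_]]; rewrite msuppX inE => /eqP -> ->.
  apply: (quotient_monomial0 (lem_addl _ _)); apply/ker/GP.
  exists [:: (1, x.2)]; split=> [y|]; first by rewrite inE => /eqP ->; apply: (sG x).
  by rewrite big_seq1 mul1r.
rewrite [f]mpolyE raddf_sum big_seq big1 // => m /f0 m0.
by rewrite /= -mul_mpolyC quotient_mul0.
Qed.

Lemma quotient_pihomog f D : pi f = 0 -> pi (pihomog mdeg D f) = 0.
Proof.
move=> /quotient_support f0; apply/quotient_support => m.
rewrite mcoeff_msupp mcoeff_pihomog; case: ifP => _; last by rewrite eqxx.
by rewrite -mcoeff_msupp => /f0.
Qed.

Lemma minimal_generator_below m : pi 'X_[m] = 0 ->
  exists2 m', minimal_generator I m' & (m' <= m)%MM.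
Proof.
have [_ ker] := hR.
move: {2}(mdeg m).+1 (ltnSn (mdeg m)) => N; elim: N m => // N IHN m lt_m m0.
have [|nmin] := classic (minimal_generator I m); first by exists m; rewrite ?lepm_refl.
have [m1 [Im1 [le_m1 ne]]] : exists m', I 'X_[m'] /\ (m' <= m)%MM /\ m' <> m.
  apply: NNPP => none; case: nmin; split; first exact/ker.
  by move=> m1 Im1 le_m1; apply: NNPP => ne; case: none; exists m1.
have [||m' minm' le_m'] := IHN m1; last by exists m' => //; apply: lepm_trans le_m1.
  apply: (@leq_trans (mdeg m)) => //; rewrite ltnNge; apply/negP => le.
  by case: ne; apply: lem_mdeg_eq.
exact/ker.
Qed.

(** The degree bound gives finiteness: the minimal generators form a subtype of the finite type of
    monomials of degree at most [d], with excluded middle as the boolean test. *)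
Lemma finite_generators d :
    (forall m, minimal_generator I m -> (mdeg m <= d)%N) ->
  exists (T : finType) (g : T -> 'X_{1..n}),
    (forall a, (mdeg (g a) <= d)%N) /\
    forall f, pi f = 0 <-> {in msupp f, forall m, divisor g m}.
Proof.
move=> hgen; pose gen (m : 'X_{1..n < d.+1}) : bool :=
  if excluded_middle_informative (minimal_generator I m) then true else false.
exists {m | gen m}, (fun a => bmnm (val a)).
have [_ ker] := hR; split=> [a|f]; first by rewrite -ltnS bmdeg.
rewrite quotient_support; split=> f0 m /f0; rewrite /divisor.
  case/minimal_generator_below => m' minm' le_m'.
  have ltm' : (mdeg m' < d.+1)%N by rewrite ltnS hgen.
  have genm' : gen (BMultinom ltm').
    by rewrite /gen; case: excluded_middle_informative.
  by case: pickP => // /(_ (Sub _ genm')); rewrite SubK /= le_m'.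
case: pickP => // -[a gena] /= le_a _; apply: (quotient_monomial0 le_a).
clear le_a; move: gena; rewrite /gen.
by case: excluded_middle_informative => // minm _; apply/ker; case: minm.
Qed.

End MonomialQuotient.

(** An integer [N] is at most the ceiling of [x] exactly when [N - 1 < x]; doubled and written over
    the naturals, this is the hypothesis. *)
Lemma nat_le_ceil_half d i N : (2 * N + i <= 2 * d * i + 1)%N ->
  N%:Z <= Num.ceil ((2 * d%:R - 1) * i%:R / 2 : rat).
Proof.
rewrite -(ler_nat rat) !natrD !natrM => le.
set x := _ / 2; suff : N%:Z - 1 < Num.ceil x by lia.
rewrite ceil_gt_int rmorphB /= -pmulrn /x; lra.
Qed.

Theorem corollary4p2 (K : fieldType) (n e d : nat)
  (he : (2 <= e)%N) (hed : (e <= d)%N)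
  (I : {mpoly K[n]} -> Prop) (hI : monomial_ideal I)
  (hgen : forall m : 'X_{1..n}, minimal_generator I m -> (e <= mdeg m <= d)%N)
  (R : lmodType {mpoly K[n]}) (pi : {linear {mpoly K[n]}^o -> R})
  (hR : quotient_map I pi)
  (F : graded_free_resolution pi)
  (p : nat) (hp : projective_dimension R p)
  (t : nat -> nat) (ht : forall i : nat, (i <= p)%N -> maximal_shift F i (t i))
  (hp2 : (2 <= p)%N) (ht2 : (t 2 < 2 * e)%N) :
  forall i : nat, (2 <= i <= p)%N ->
    (t i)%:Z <= Num.ceil ((2 * d%:R - 1) * i%:R / 2 : rat) - 2 * (d%:Z - e%:Z).
Proof.
have [|T [g [deg_g pi_ker]]] := @finite_generators n K I hI R pi hR d.
  by move=> m /hgen /andP[].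
(* Nonvanishing is transferred between [F] and the Taylor resolution, so the shifts of [F] are read
   off from [acyclic]. *)
have bettiP i j : betti F i.+1 j <> 0%N <->
    exists m, mdeg m = j /\ ~ acyclic g K i.+1 m.
  rewrite -(taylor_betti hR.1 pi_ker).
  by split; apply: betti_neq0_transfer; apply: quotient_pihomog hR.
have t_max i m : (i < p)%N -> (t i.+1 < mdeg m)%N -> acyclic g K i.+1 m.
  move=> lt_ip lt_t; apply: NNPP => nacyc.
  have [_ /(_ (mdeg m))] := ht _ lt_ip.
  by rewrite leqNgt lt_t => /(_ ((bettiP _ _).2 (ex_intro _ m (conj erefl nacyc)))).
have t_att i : (i < p)%N -> exists m, mdeg m = t i.+1 /\ ~ acyclic g K i.+1 m.
  by move=> lt_ip; have [/bettiP] := ht _ lt_ip.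
have step1 i : (0 < i)%N -> (i < p)%N -> (t i.+1 <= t i + d)%N.
  case: i => // i _ lt_ip; have [m [<- nacyc]] := t_att _ lt_ip.
  rewrite leqNgt; apply/negP => lt_t; apply: nacyc.
  apply: (acyclic_deg_step deg_g) => m' le; apply: t_max; first exact: ltnW.
  by move: lt_t le; lia.
have step2 i : (2 <= i)%N -> (i.+2 <= p)%N -> (t i.+2 < t i + 2 * d)%N.
  case: i => // i i_gt0 lt_ip; have [m [<- nacyc]] := t_att _ lt_ip.
  (* This bound yields the vanishing needed in the intermediate homological degree. *)
  have := step1 i.+1 isT (ltnW lt_ip) => le1.
  rewrite ltnNge; apply/negP => le_t; apply: nacyc.
  apply: (acyclic_syzygy_step deg_g).
  - lia.
  - lia.
  - by move=> m' le'; apply: t_max => //; lia.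
  - by move=> m' lt'; apply: t_max; lia.
  - by move=> m' lt'; apply: t_max; lia.
move=> i /andP[i_ge2 le_ip].
(* [N] bounds [t i + 2 * (d - e)], written without subtraction. *)
suff [N [leN /nat_le_ceil_half leC]] : exists N,
    (t i + 2 * d <= 2 * e + N)%N /\ (2 * N + i <= 2 * d * i + 1)%N.
  by lia.
have {i_ge2} [q iE] : exists q, i = q.*2.+2 \/ i = q.*2.+3.
  by exists i.-2./2; have := odd_double_half i.-2; case: odd => /=; lia.
elim: q i iE le_ip => [|q IHq] i iE le_ip.
  (* For [i = 2], [t 2 <= 2 * e - 1] gives [2 * d - 1]; for [i = 3], [step1] adds [d]. Afterwards
     [step2] adds [2 * d - 1] per two homological degrees. *)
  case: iE le_ip => ->; rewrite double0 => le_ip.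
    by exists (2 * d - 1)%N; lia.
  by exists (3 * d - 1)%N; have := step1 2%N isT le_ip; lia.
have iE' : i.-2 = q.*2.+2 \/ i.-2 = q.*2.+3 by lia.
have [|N [leN leNi]] := IHq _ iE'; first by lia.
exists (N + 2 * d - 1)%N; have := step2 i.-2.
have -> : i.-2.+2 = i by lia.
move=> /(_ _ le_ip) h; have {}h := h (ltac:(lia)); split; first by lia.
have -> : (2 * d * i = 2 * d * i.-2 + 4 * d)%N by nia.
by lia.
Qed.
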